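(* Let $k$ be a field and let $M,B,\mathcal{R}$ be $k$-algebras with $M^2=0$ and $B=k\langle X_+\mid R\rangle$, where $R=\{u-f_u\mid u\in\Lambda\}$ is a minimal Gröbner-Shirshov basis for $B$ with respect to the deg-lex order on $X^+$, $u$ being the leading word of $h_u=u-f_u$ in $k\langle X_+\rangle$. Then $\mathcal{R}$ is (isomorphic to) an extension of $M$ by $B$ if and only if there exist a $B$-bimodule structure on $M$ and a family $\{(u)\mid u\in\Lambda\}$ of elements of $M$ such that $$g_{(u_1,u_2)_w}=0\ \text{ in } M\quad\text{for every composition } (h_{u_1},h_{u_2})_w\text{ in } R,$$ and $$\mathcal{R}\cong k\langle(\{m_j\}_{j\in J}\cup X)_+\mid S_1\rangle$$ as $k$-algebras, where $\{m_j\}_{j\in J}$ is a $k$-basis of $M$ and $S_1$ consists of the relations $$u=f_u+(u),\quad xm_j=[xm_j],\quad m_jx=[m_jx],\quad m_jm_l=0\qquad(u\in\Lambda,\ x\in X,\ j,l\in J).$$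
   Context: All algebras are associative over the field $k$ and need not have an identity. A $B$-bimodule is a $k$-vector space $M$ with $k$-bilinear left and right actions of $B$ satisfying $(bb')m=b(b'm)$, $m(bb')=(mb)b'$, $(bm)b'=b(mb')$. For a set $Y$, $Y^*$ is the set of all words on $Y$, $Y^+$ the set of nonempty words, $k\langle Y_+\rangle$ the free associative $k$-algebra without identity on $Y$ (the $k$-span of $Y^+$), and $k\langle Y_+\mid S\rangle$ its quotient by the ideal generated by $S$; a relation $u=v$ stands for the polynomial $u-v$. Gröbner-Shirshov bases. Let $Y$ be well ordered. The deg-lex order compares words first by length, then lexicographically. $\bar f$ denotes the leading (largest) word of $f\neq 0$; $f$ is monic if $\bar f$ has coefficient $1$. For monic $f,g$: if $w=\bar fb=a\bar g$ with $a,b\in Y^*$ and $\deg\bar f+\deg\bar g>\deg w$, then $(f,g)_w=fb-ag$ (intersection composition); if $w=\bar f=a\bar gb$ with $a,b\in Y^*$, then $(f,g)_w=f-agb$ (inclusion composition). A composition $(f,g)_w$ is trivial modulo a set $S$ of monic polynomials if $(f,g)_w=\sum\alpha_ia_is_ib_i$ with $\alpha_i\in k$, $a_i,b_i\in Y^*$, $s_i\in S$ and $\overline{a_is_ib_i}<w$ for all $i$. $S$ is a Gröbner-Shirshov basis if every composition of elements of $S$ is trivial modulo $S$. It is minimal if no leading word of an element of $S$ is a subword of the leading word of another element (in particular, the leading words are pairwise different). Here $X$ is well ordered. $[xm_j]$ and $[m_jx]$ denote the results of the left and right actions on $m_j$ of the class of $x$ in $B$, written as linear combinations of the generators $m_j$;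 $(u)\in M$ is likewise written as a linear combination of the $m_j$. Words of $X^*$ act on $M$ through their classes in $B$, the empty word acting as the identity. The elements $g_{(u_1,u_2)_w}$. Since $R$ is minimal, the compositions in $R$ are intersection ones: $w=u_1c=du_2$ with $u_1,u_2\in\Lambda$, $c,d\in X^+$, $\deg u_1+\deg u_2>\deg w$. As $R$ is a Gröbner-Shirshov basis, one can write in $k\langle X_+\rangle$ $$(h_{u_1},h_{u_2})_w=df_{u_2}-f_{u_1}c=\sum_i\alpha_ia_i(u_i'-f_{u_i'})b_i,$$ with $\alpha_i\in k$, $a_i,b_i\in X^*$, $u_i'\in\Lambda$, $a_iu_i'b_i<w$. Fix one such expression for each composition and put $$g_{(u_1,u_2)_w}=\sum_i\alpha_ia_i(u_i')b_i-\big((u_1)c-d(u_2)\big)\in M,$$ computed with the bimodule actions. An algebra $\mathcal{R}$ is an extension of $M$ by $B$ if $M^2=0$, $M$ is an ideal of $\mathcal{R}$ and $\mathcal{R}/M\cong B$ as algebras. ''$\mathcal{R}$ is isomorphic to an extension of $M$ by $B$'' means: $\mathcal{R}$ has a two-sided ideal $N$ with $N\cong M$ as algebras and $\mathcal{R}/N\cong B$ as algebras. *)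

(* Defs.v *)
From HB Require Import structures.
From mathcomp Require Import all_boot all_order all_algebra finmap.
From mathcomp Require Import boolp monalg.

Set Implicit Arguments.
Unset Strict Implicit.
Unset Printing Implicit Defensive.

Import Order.TTheory GRing.Theory.
Local Open Scope ring_scope.
Local Open Scope quotient_scope.

HB.mixin Record Lmodule_isNAlg (k : fieldType) A of GRing.Lmodule k A := {
  nmul : A -> A -> A;
  nmulA : associative nmul;
  nmulDl : left_distributive nmul +%R;
  nmulDr : right_distributive nmul +%R;
  nmulZl : forall (a : k) (x y : A), nmul (a *: x) y = a *: nmul x y;
  nmulZr : forall (a : k) (x y : A), nmul x (a *: y) = a *: nmul x y
}.

#[short(type="nalgType")]
HB.structure Definition NAlg (k : fieldType) :=
  {A of Lmodule_isNAlg k A & GRing.Lmodule k A}.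

Notation "x ** y" := (nmul x y) (at level 40, left associativity) : ring_scope.

Section NAlgTheory.
Variables (k : fieldType) (A : nalgType k).
Implicit Types x y z : A.

Lemma nmul0r x : 0 ** x = 0.
Proof. by rewrite -[X in X ** _](scale0r (0 : A)) nmulZl scale0r. Qed.
Lemma nmulr0 x : x ** 0 = 0.
Proof. by rewrite -[X in _ ** X](scale0r (0 : A)) nmulZr scale0r. Qed.
Lemma nmulBl x y z : (x - y) ** z = x ** z - y ** z.
Proof. by rewrite nmulDl -scaleN1r nmulZl scaleN1r. Qed.
Lemma nmulBr x y z : x ** (y - z) = x ** y - x ** z.
Proof. by rewrite nmulDr -scaleN1r nmulZr scaleN1r. Qed.

End NAlgTheory.

Definition alg_iso (k : fieldType) (A B : nalgType k) : Prop :=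
  exists f : {linear A -> B}, {morph f : x y / x ** y} /\ bijective f.

Record ideal (k : fieldType) (A : nalgType k) := Ideal {
  ideal_set :> A -> Prop;
  ideal0 : ideal_set 0;
  idealD : forall x y, ideal_set x -> ideal_set y -> ideal_set (x + y);
  idealZ : forall (a : k) x, ideal_set x -> ideal_set (a *: x);
  idealMl : forall x y, ideal_set y -> ideal_set (x ** y);
  idealMr : forall x y, ideal_set x -> ideal_set (x ** y)
}.

Section Ideals.
Variables (k : fieldType) (A : nalgType k).

Definition ideal_pred (N : ideal A) : {pred A} := fun x => `[< N x >].

Lemma ideal_predP (N : ideal A) (x : A) : reflect (N x) (x \in ideal_pred N).
Proof. exact: asboolP. Qed.

Fact ideal_submod_closed N : GRing.subsemimod_closed (ideal_pred N).
Proof.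
split; first split.
- by apply/ideal_predP/ideal0.
- by move=> x y /ideal_predP Nx /ideal_predP Ny; apply/ideal_predP/idealD.
- by move=> a x /ideal_predP Nx; apply/ideal_predP/idealZ.
Qed.

HB.instance Definition _ N :=
  GRing.isSubmodClosed.Build k A (ideal_pred N) (ideal_submod_closed N).

Definition gen_ideal_set (S : A -> Prop) : A -> Prop :=
  fun x => forall N : ideal A, (forall s, S s -> N s) -> N x.

Definition gen_ideal (S : A -> Prop) : ideal A.
Proof.
apply: (@Ideal k A (gen_ideal_set S)).
- by move=> N _; apply: ideal0.
- by move=> x y Nx Ny N SN; apply: idealD; [apply: Nx | apply: Ny].
- by move=> a x Nx N SN; apply: idealZ; apply: Nx.
- by move=> x y Ny N SN; apply: idealMl; apply: Ny.
- by move=> x y Nx N SN; apply: idealMr; apply: Nx.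
Defined.

End Ideals.

Section IdealAlgebra.
Variables (k : fieldType) (A : nalgType k) (N : ideal A).

Record ideal_alg := IdealAlg {
  ideal_val :> A;
  ideal_valP : ideal_val \in ideal_pred N
}.

HB.instance Definition _ := [isSub for ideal_val].
HB.instance Definition _ := [Choice of ideal_alg by <:].
HB.instance Definition _ := [SubChoice_isSubLmodule of ideal_alg by <:].

Fact ideal_mul_subproof (x y : ideal_alg) : val x ** val y \in ideal_pred N.
Proof. by apply/ideal_predP/idealMr/ideal_predP/valP. Qed.
Definition ideal_mul (x y : ideal_alg) := IdealAlg (ideal_mul_subproof x y).

Fact ideal_mulA : associative ideal_mul.
Proof. by move=> x y z; apply/val_inj/nmulA. Qed.
Fact ideal_mulDl : left_distributive ideal_mul +%R.
Proof. by move=> x y z; apply/val_inj/nmulDl. Qed.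
Fact ideal_mulDr : right_distributive ideal_mul +%R.
Proof. by move=> x y z; apply/val_inj/nmulDr. Qed.
Fact ideal_mulZl (a : k) (x y : ideal_alg) :
  ideal_mul (a *: x) y = a *: ideal_mul x y.
Proof. by apply/val_inj/nmulZl. Qed.
Fact ideal_mulZr (a : k) (x y : ideal_alg) :
  ideal_mul x (a *: y) = a *: ideal_mul x y.
Proof. by apply/val_inj/nmulZr. Qed.

HB.instance Definition _ := Lmodule_isNAlg.Build k ideal_alg
  ideal_mulA ideal_mulDl ideal_mulDr ideal_mulZl ideal_mulZr.

End IdealAlgebra.

Section QuotientAlgebra.
Variables (k : fieldType) (A : nalgType k) (N : ideal A).

Definition quot_alg := Quotient.quot (ideal_pred N).

HB.instance Definition _ := GRing.Zmodule.on quot_alg.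
HB.instance Definition _ := EqQuotient.on quot_alg.

Definition quot_pi (x : A) : quot_alg := \pi x.

Lemma quot_piP (x y : A) : quot_pi x = quot_pi y <-> N (x - y).
Proof.
have E := Quotient.idealrBE (ideal_pred N) x y.
split=> [/eqP xy | /ideal_predP Nxy]; first by apply/ideal_predP; rewrite E.
by apply/eqP; rewrite E in Nxy.
Qed.

Lemma quot_piK (x : quot_alg) : quot_pi (repr x) = x.
Proof. exact: reprK. Qed.

Lemma quot_piD (x y : A) : quot_pi (x + y) = quot_pi x + quot_pi y.
Proof. by rewrite /quot_pi !piE. Qed.

Definition quot_scale (a : k) (x : quot_alg) : quot_alg :=
  quot_pi (a *: repr x).
Definition quot_mul (x y : quot_alg) : quot_alg := quot_pi (repr x ** repr y).

Lemma quot_scale_pi a x : quot_scale a (quot_pi x) = quot_pi (a *: x).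
Proof.
by apply/quot_piP; rewrite -scalerBr; apply/idealZ/quot_piP; rewrite quot_piK.
Qed.

Lemma quot_mul_pi x y : quot_mul (quot_pi x) (quot_pi y) = quot_pi (x ** y).
Proof.
apply/quot_piP; set x' := repr _; set y' := repr _.
have -> : x' ** y' - x ** y = (x' - x) ** y' + x ** (y' - y).
  by rewrite nmulBl nmulBr addrA subrK.
by apply: idealD; [apply: idealMr | apply: idealMl]; apply/quot_piP;
  rewrite quot_piK.
Qed.

Fact quot_scaleA a b x : quot_scale a (quot_scale b x) = quot_scale (a * b) x.
Proof. by rewrite -[x]quot_piK !quot_scale_pi scalerA. Qed.
Fact quot_scale1 : left_id 1 quot_scale.
Proof. by move=> x; rewrite -[x]quot_piK quot_scale_pi scale1r. Qed.
Fact quot_scaleDr : right_distributive quot_scale +%R.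
Proof.
move=> a x y; rewrite -[x]quot_piK -[y]quot_piK.
by rewrite -quot_piD !quot_scale_pi scalerDr quot_piD.
Qed.
Fact quot_scaleDl x : {morph quot_scale^~ x : a b / a + b}.
Proof.
by move=> a b /=; rewrite -[x]quot_piK !quot_scale_pi scalerDl quot_piD.
Qed.

HB.instance Definition _ := GRing.Zmodule_isLmodule.Build k quot_alg
  quot_scaleA quot_scale1 quot_scaleDr quot_scaleDl.

Fact quot_mulA : associative quot_mul.
Proof.
move=> x y z; rewrite -[x]quot_piK -[y]quot_piK -[z]quot_piK.
by rewrite !quot_mul_pi nmulA.
Qed.
Fact quot_mulDl : left_distributive quot_mul +%R.
Proof.
move=> x y z; rewrite -[x]quot_piK -[y]quot_piK -[z]quot_piK.
by rewrite -quot_piD !quot_mul_pi nmulDl quot_piD.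
Qed.
Fact quot_mulDr : right_distributive quot_mul +%R.
Proof.
move=> x y z; rewrite -[x]quot_piK -[y]quot_piK -[z]quot_piK.
by rewrite -quot_piD !quot_mul_pi nmulDr quot_piD.
Qed.
Fact quot_mulZl (a : k) (x y : quot_alg) :
  quot_mul (a *: x) y = a *: quot_mul x y.
Proof.
rewrite -[x]quot_piK -[y]quot_piK [a *: quot_pi _]quot_scale_pi !quot_mul_pi.
by rewrite nmulZl; symmetry; apply: quot_scale_pi.
Qed.
Fact quot_mulZr (a : k) (x y : quot_alg) :
  quot_mul x (a *: y) = a *: quot_mul x y.
Proof.
rewrite -[x]quot_piK -[y]quot_piK [a *: quot_pi _]quot_scale_pi !quot_mul_pi.
by rewrite nmulZr; symmetry; apply: quot_scale_pi.
Qed.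

HB.instance Definition _ := Lmodule_isNAlg.Build k quot_alg
  quot_mulA quot_mulDl quot_mulDr quot_mulZl quot_mulZr.

End QuotientAlgebra.

Definition is_extension_of (k : fieldType) (M B E : nalgType k) : Prop :=
  exists N : ideal E, alg_iso (ideal_alg N) M /\ alg_iso (quot_alg N) B.

(** [{fmonom Y}] is the library's free monoid on [Y]: its elements coerce to
    [seq Y], its product is concatenation and its unit is the empty word. *)
Notation "1" := (@mone _) : monom_scope.
Notation "x * y" := (mmul x y) : monom_scope.

Definition letter (Y : choiceType) (y : Y) : {fmonom Y} := FMonom [:: y].
Definition map_word (Y Z : choiceType) (e : Y -> Z) (w : {fmonom Y}) :
  {fmonom Z} := FMonom (map e w).

(** [{malg k[{fmonom Y}]}] is the free associative algebra with identity. The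
    free algebra without identity is its subspace spanned by the nonempty
    words. *)
Section FreeAlgebra.
Variables (k : fieldType) (Y : choiceType).
Local Notation kY := {malg k[{fmonom Y}]}.

Definition no_const : {pred kY} := fun p => p@_1%M == 0.

Fact no_const_closed : GRing.subsemimod_closed no_const.
Proof.
split; first split.
- by rewrite unfold_in mcoeff0.
- by move=> p q /eqP p0 /eqP q0; rewrite unfold_in mcoeffD p0 q0 addr0.
- by move=> a p /eqP p0; rewrite unfold_in mcoeffZ p0 mulr0.
Qed.

HB.instance Definition _ :=
  GRing.isSubmodClosed.Build k kY no_const no_const_closed.

Record free_alg := FreeAlg { free_val :> kY; free_valP : free_val \in no_const }.

HB.instance Definition _ := [isSub for free_val].
HB.instance Definition _ := [Choice of free_alg by <:].
HB.instance Definition _ := [SubChoice_isSubLmodule of free_alg by <:].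

Fact free_mul_subproof (p q : free_alg) : val p * val q \in no_const.
Proof.
rewrite unfold_in; have [/eqP p0] := (valP p, valP q).
by rewrite (rmorphM (mcoeff 1%M)) /= p0 mul0r.
Qed.
Definition free_mul (p q : free_alg) := FreeAlg (free_mul_subproof p q).

Fact free_mulA : associative free_mul.
Proof. by move=> p q r; apply/val_inj/mulrA. Qed.
Fact free_mulDl : left_distributive free_mul +%R.
Proof. by move=> p q r; apply/val_inj/mulrDl. Qed.
Fact free_mulDr : right_distributive free_mul +%R.
Proof. by move=> p q r; apply/val_inj/mulrDr. Qed.
Fact free_mulZl (a : k) (p q : free_alg) :
  free_mul (a *: p) q = a *: free_mul p q.
Proof. by apply/val_inj; rewrite /= -scalerAl. Qed.
Fact free_mulZr (a : k) (p q : free_alg) :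
  free_mul p (a *: q) = a *: free_mul p q.
Proof.
have mulC (r : kY) : r * a%:MP = a *: r.
  rewrite malgM_def fgmulgU malgZ_def; apply: eq_bigr => w _.
  by rewrite mulrC mulm1.
by apply/val_inj; rewrite /= -mul_malgC mulrA mulC -scalerAl.
Qed.

HB.instance Definition _ := Lmodule_isNAlg.Build k free_alg
  free_mulA free_mulDl free_mulDr free_mulZl free_mulZr.

(** The nonempty word [w] as an element of the free algebra without identity;
    by convention the empty word is sent to [0]. *)
Definition free_word (w : {fmonom Y}) : free_alg := insubd 0 << w >>.

Definition presented (S : free_alg -> Prop) := quot_alg (gen_ideal S).

Definition class (S : free_alg -> Prop) (p : free_alg) : presented S :=
  quot_pi (gen_ideal S) p.

End FreeAlgebra.

Definition free_map (k : fieldType) (Y Z : choiceType) (e : Y -> Z)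
    (p : free_alg k Y) : free_alg k Z :=
  \sum_(w <- msupp (val p)) (val p)@_w *: free_word k (map_word e w).

Section GroebnerShirshov.
Variables (k : fieldType) (d : Order.disp_t) (X : orderType d).
Local Notation word := {fmonom X}.
Local Notation kX := {malg k[word]}.

Definition deglex_le (u v : word) : bool :=
  (size u < size v)%N ||
  (size u == size v) && ((u : seqlexi X) <= (v : seqlexi X))%O.
Definition deglex_lt (u v : word) : bool := (u != v) && deglex_le u v.

(** The leading word; [lead 0 = 1%M] by convention. *)
Definition lead (p : kX) : word :=
  \big[(fun u v => if deglex_le u v then v else u)/1%M]_(w <- msupp p) w.

Definition monic (p : kX) : Prop := p@_(lead p) = 1.

Inductive composition (f g : kX) (w : word) : kX -> Prop :=
| Intersection_comp (a b : word) of
    w = (lead f * b)%M & w = (a * lead g)%M &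
    (size w < size (lead f) + size (lead g))%N :
    composition f g w (f * << b >> - << a >> * g)
| Inclusion_comp (a b : word) of
    w = lead f & w = (a * lead g * b)%M :
    composition f g w (f - << a >> * g * << b >>).

Definition trivial_mod (S : free_alg k X -> Prop) (w : word) (p : kX) : Prop :=
  exists t : seq (k * word * free_alg k X * word),
    p = \sum_(i <- t)
          (let: (alpha, a, s, b) := i in alpha *: (<< a >> * val s * << b >>))
    /\ (forall alpha a s b, (alpha, a, s, b) \in t ->
          S s /\ deglex_lt (lead (<< a >> * val s * << b >>)) w).

Definition GS_basis (S : free_alg k X -> Prop) : Prop :=
  (forall s, S s -> monic (val s)) /\
  (forall f g, S f -> S g ->
   forall w p, composition (val f) (val g) w p -> trivial_mod S w p).

Definition GS_minimal (S : free_alg k X -> Prop) : Prop :=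
  forall f g, S f -> S g -> f <> g ->
  ~~ infix (lead (val f)) (lead (val g)).

(** The set [{u - f_u | u in Lam}]; [f] is only relevant on [Lam]. *)
Definition rels (Lam : word -> Prop) (f : word -> free_alg k X) :
    free_alg k X -> Prop :=
  fun p => exists2 u, Lam u & p = free_word k u - f u.

(** The composition with [w = u1 * c = dw * u2]. *)
Definition overlap (Lam : word -> Prop) (u1 u2 c dw : word) : Prop :=
  [/\ Lam u1 /\ Lam u2, c != 1%M, dw != 1%M, (u1 * c = dw * u2)%M
    & (size (u1 * c)%M < size u1 + size u2)%N].

(** [e] lists the terms [(alpha_i, a_i, u_i', b_i)] of an expression of the
    composition [d f_{u2} - f_{u1} c] through the relators. *)
Definition expresses (Lam : word -> Prop) (f : word -> free_alg k X)
    (u1 u2 c dw : word) (e : seq (k * word * word * word)) : Prop :=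
  << dw >> * val (f u2) - val (f u1) * << c >>
    = \sum_(i <- e) (let: (alpha, a, u, b) := i in
        alpha *: (<< a >> * (<< u >> - val (f u)) * << b >>))
  /\ (forall alpha a u b, (alpha, a, u, b) \in e ->
        Lam u /\ deglex_lt (a * u * b)%M (u1 * c)%M).

End GroebnerShirshov.

Record bimodule (k : fieldType) (B : nalgType k) (M : lmodType k) := Bimodule {
  lact : B -> M -> M;
  ract : M -> B -> M;
  lact_linearl : forall v, linear (lact^~ v);
  lact_linearr : forall b, linear (lact b);
  ract_linearl : forall b, linear (ract^~ b);
  ract_linearr : forall v, linear (ract v);
  lactM : forall b b' v, lact (b ** b') v = lact b (lact b' v);
  ractM : forall b b' v, ract v (b ** b') = ract (ract v b) b';
  lractA : forall b b' v, ract (lact b v) b' = lact b (ract v b')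
}.

Section WordAction.
Variables (k : fieldType) (X : choiceType) (S : free_alg k X -> Prop).
Variables (M : lmodType k) (K : bimodule (presented S) M).

Definition lact_word (w : {fmonom X}) (v : M) : M :=
  if w == 1%M then v else lact K (class S (free_word k w)) v.

Definition ract_word (v : M) (w : {fmonom X}) : M :=
  if w == 1%M then v else ract K v (class S (free_word k w)).

(** The element [g_{(u1,u2)_w}], [w = u1 * c = dw * u2], computed from the
    expression [e] and the family [mu u = (u)]. *)
Definition g_elt (mu : {fmonom X} -> M) (u1 u2 c dw : {fmonom X})
    (e : seq (k * {fmonom X} * {fmonom X} * {fmonom X})) : M :=
  \sum_(i <- e) (let: (alpha, a, u, b) := i in
      alpha *: ract_word (lact_word a (mu u)) b)
  - (ract_word (mu u1) c - lact_word dw (mu u2)).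

End WordAction.

Definition lincomb (k : fieldType) (M : lmodType k) (J : choiceType)
    (m : J -> M) (c : {malg k[J]}) : M := \sum_(j <- msupp c) c@_j *: m j.

Definition is_basis (k : fieldType) (M : lmodType k) (J : choiceType)
    (m : J -> M) : Prop :=
  forall v, exists! c : {malg k[J]}, lincomb m c = v.

Section ExtensionPresentation.
Variables (k : fieldType) (X : choiceType) (S : free_alg k X -> Prop).
Variables (M : lmodType k) (K : bimodule (presented S) M).
Variables (J : choiceType) (m : J -> M).
Variables (Lam : {fmonom X} -> Prop) (f : {fmonom X} -> free_alg k X).
Variable mu : {fmonom X} -> M.

Local Notation Y := (J + X)%type.

Definition gen_m (j : J) : {fmonom Y} := letter (inl j).
Definition gen_x (x : X) : {fmonom Y} := letter (inr x).

Definition free_lin (c : {malg k[J]}) : free_alg k Y :=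
  \sum_(j <- msupp c) c@_j *: free_word k (gen_m j).

(** When [m] is a basis, the coefficients [c] below are those of the unique
    expression of the given element of [M] in that basis. *)
Inductive ext_rels : free_alg k Y -> Prop :=
| Ext_rel u c of Lam u & lincomb m c = mu u :
    ext_rels (free_word k (map_word inr u)
              - (free_map (inr : X -> Y) (f u) + free_lin c))
| Ext_left x j c of
    lincomb m c = lact K (class S (free_word k (letter x))) (m j) :
    ext_rels (free_word k (gen_x x * gen_m j)%M - free_lin c)
| Ext_right j x c of
    lincomb m c = ract K (m j) (class S (free_word k (letter x))) :
    ext_rels (free_word k (gen_m j * gen_x x)%M - free_lin c)
| Ext_sq j l : ext_rels (free_word k (gen_m j * gen_m l)%M).

End ExtensionPresentation.

(* Main.v *)
(** Write F for the free algebra on X, B = F/(R) and h_u = u - f_u. An algebra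
    map out of the presented algebra P = k<m_j, X | S_1> is the same thing as a
    map s : X -> A together with a linear i : M -> A such that i(M)^2 = 0,
    s(h_u) = i((u)), and i intertwines the bimodule actions with multiplication
    by s(x). In P every element has the form s(q) + i(v), and s(q) lies in i(M)
    as soon as q vanishes in B.

    Given an extension E of M by B, any lift s of the letters induces the
    bimodule structure, (u) is defined by i((u)) = s(h_u), applying s to the
    expression of a composition gives g = 0, and the induced map P -> E is
    bijective by the previous remark.

    Conversely the only point is that M embeds in P. By recursion along the
    deg-lex order one defines a linear map nu : F -> M with
    nu(a h_u b) = a (u) b for one chosen decomposition of each reducible word;
    the conditions g = 0 and the minimality of R are exactly what makes this
    formula hold for all a, u, b. Then {(p, -nu p) | p in (R)} is an ideal of
    the semidirect product F + M, meeting M trivially, and P maps to the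
    quotient by it. *)

Require Import Defs.
From HB Require Import structures.
From mathcomp Require Import all_boot all_order all_algebra finmap.
From mathcomp Require Import boolp monalg.

Set Implicit Arguments.
Unset Strict Implicit.
Unset Printing Implicit Defensive.

Import Order.TTheory GRing.Theory.
Local Open Scope ring_scope.

(** * Free algebras *)

Section LinearExtension.
Variables (k : fieldType) (K : choiceType) (V : lmodType k) (g : K -> V).

(** [lincomb], [free_lin] and [free_lift] unfold to instances of this map, so its linearity serves
    for all of them. *)
Definition lext (c : {malg k[K]}) : V := \sum_(w <- msupp c) c@_w *: g w.

Lemma lextEw (D : {fset K}) c :
  (msupp c `<=` D)%fset -> lext c = \sum_(w <- D) c@_w *: g w.
Proof.
move=> sub; rewrite /lext (big_fset_incl _ sub) // => w _ /mcoeff_outdom ->.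
by rewrite scale0r.
Qed.

Fact lext_is_linear : linear lext.
Proof.
move=> a p q; pose D := (msupp p `|` msupp q)%fset.
have sub : (msupp (a *: p + q) `<=` D)%fset.
  apply: fsubset_trans (msuppD_le _ _) _.
  by apply: fsetSU; apply: msuppZ_le.
rewrite (lextEw sub) (lextEw (fsubsetUl _ _ : (msupp p `<=` D)%fset)).
rewrite (lextEw (fsubsetUr _ _ : (msupp q `<=` D)%fset)).
rewrite scaler_sumr -big_split /=; apply: eq_bigr => w _.
by rewrite mcoeffD mcoeffZ scalerDl scalerA.
Qed.

HB.instance Definition _ :=
  GRing.isLinear.Build k {malg k[K]} V _ lext lext_is_linear.

Lemma lextU w : lext << w >> = g w.
Proof. by rewrite /lext msuppU oner_eq0 big_seq_fset1 mcoeffUU scale1r. Qed.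

End LinearExtension.

Lemma malgUZ (k : fieldType) (K : choiceType) (w : K) (a : k) :
  << a *g w >> = a *: << w >> :> {malg k[K]}.
Proof.
by apply/malgP => w'; rewrite mcoeffZ !mcoeffU mulrnAr mulr1.
Qed.

Lemma malgE_lext (k : fieldType) (K : choiceType) (c : {malg k[K]}) :
  c = lext (fun w => << w >>) c.
Proof. by rewrite [LHS]monalgE; apply: eq_bigr => w _; rewrite malgUZ. Qed.

Lemma malg_scaleAr (k : fieldType) (K : monomType) (a : k)
    (p q : {malg k[K]}) : p * (a *: q) = a *: (p * q).
Proof.
have mulC (r : {malg k[K]}) : r * a%:MP = a *: r.
  rewrite malgM_def fgmulgU malgZ_def; apply: eq_bigr => w _.
  by rewrite mulrC mulm1.
by rewrite -mul_malgC mulrA mulC -scalerAl.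
Qed.

Lemma mulr_sandwich (A : pzRingType) (a a' p b' b : A) :
  a * (a' * p * b') * b = a * a' * p * (b' * b).
Proof. by rewrite !mulrA. Qed.

Lemma malgUM (k : fieldType) (K : monomType) (u v : K) :
  << u >> * << v >> = << (u * v)%M >> :> {malg k[K]}.
Proof. by rewrite malgM_def fgmulUU mulr1. Qed.

Section FreeAlgebraTheory.
Variables (k : fieldType) (Y : choiceType).
Implicit Types (w a b : {fmonom Y}) (p q : free_alg k Y).

Lemma val_free_word w : w != 1%M -> val (free_word k w) = << w >>.
Proof.
move=> w1; rewrite /free_word val_insubd unfold_in mcoeffU1.
by rewrite (negbTE w1) eqxx.
Qed.

Lemma val_free_wordB w p :
  w != 1%M -> val (free_word k w - p) = << w >> - val p.
Proof. by move=> w1; rewrite -(val_free_word w1). Qed.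

Lemma free_alg_mcoeff1 p : (val p)@_1%M = 0.
Proof. by apply/eqP; apply: (valP p). Qed.

Lemma free_word1 : free_word k (1%M : {fmonom Y}) = 0.
Proof.
by rewrite /free_word /insubd insubF // unfold_in mcoeffU1 eqxx oner_eq0.
Qed.

Lemma free_algE p : p = lext (@free_word k Y) (val p).
Proof.
apply: val_inj; rewrite [LHS]malgE_lext /lext linear_sum.
apply: eq_bigr => w _; have [->|w1] := eqVneq w 1%M.
  by rewrite free_alg_mcoeff1 !scale0r.
by rewrite linearZ /= -[free_val _]/(val _) val_free_word.
Qed.

Lemma free_alg_ind (P : free_alg k Y -> Prop) :
    P 0 -> (forall p q, P p -> P q -> P (p + q)) ->
    (forall c p, P p -> P (c *: p)) ->
    (forall w, w != 1%M -> P (free_word k w)) ->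
  forall p, P p.
Proof.
move=> P0 PD PZ Pw p; rewrite (free_algE p) /lext.
elim/big_ind: _ => // w _; apply: PZ.
by have [->|/Pw//] := eqVneq w 1%M; rewrite free_word1.
Qed.

Lemma free_wordM a b : a != 1%M -> b != 1%M ->
  free_word k (a * b)%M = free_word k a ** free_word k b.
Proof.
move=> a1 b1; have ab1 : (a * b)%M != 1%M by rewrite fmM_eq1 (negbTE a1).
apply: val_inj; rewrite (val_free_word ab1) -malgUM.
by rewrite -(val_free_word a1) -(val_free_word b1).
Qed.

Lemma letter_neq1 (y : Y) : letter y != 1%M.
Proof. by rewrite fmP fm1. Qed.

Lemma FMonom_cons (y : Y) s : FMonom (y :: s) = (letter y * FMonom s)%M.
Proof. by apply/eqP; rewrite fmP fmM. Qed.

Lemma word_ind (P : {fmonom Y} -> Prop) :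
    P 1%M -> (forall y w, P w -> P (letter y * w)%M) -> forall w, P w.
Proof.
move=> P1 PM [s]; elim: s => [|y s IHs]; last by rewrite FMonom_cons; apply: PM.
by have -> // : FMonom [::] = 1%M :> {fmonom Y}; apply/eqP; rewrite fmP fm1.
Qed.

Lemma nonempty_word_ind (P : {fmonom Y} -> Prop) :
    (forall y, P (letter y)) ->
    (forall y w, w != 1%M -> P w -> P (letter y * w)%M) ->
  forall w, w != 1%M -> P w.
Proof.
move=> P1 PM; elim/word_ind => [/eqP//|y w IHw _].
have [->|w1] := eqVneq w 1%M; first by rewrite mulm1.
by apply: PM => //; apply: IHw.
Qed.

End FreeAlgebraTheory.

(** * Universal property of the free algebra without identity *)

Section FreeLift.
Variables (k : fieldType) (Y : choiceType) (A : nalgType k) (e : Y -> A).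
Implicit Types (w a b : {fmonom Y}) (p q : free_alg k Y) (z : A).

(** [A] need not have an identity, so the last letter is treated apart. The default [0] on the empty
    word agrees with [free_word1]. *)
Fixpoint seq_eval (s : seq Y) : A :=
  if s is y :: s' then if s' is [::] then e y else e y ** seq_eval s' else 0.

Definition word_eval w : A := seq_eval w.

Lemma seq_eval_cat s t :
  s != [::] -> t != [::] -> seq_eval (s ++ t) = seq_eval s ** seq_eval t.
Proof.
case: s t => // y s [|z t] // _ _; elim: s y => //= x s IHs y.
by rewrite (IHs x) nmulA.
Qed.

Lemma word_evalM a b : a != 1%M -> b != 1%M ->
  word_eval (a * b)%M = word_eval a ** word_eval b.
Proof. by rewrite !fmP fm1 /word_eval fmM; apply: seq_eval_cat. Qed.

Definition free_lift p : A := lext word_eval (val p).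

Fact free_lift_is_linear : linear free_lift.
Proof. by move=> c p q; rewrite /free_lift !linearP. Qed.

HB.instance Definition _ :=
  GRing.isLinear.Build k (free_alg k Y) A _ free_lift free_lift_is_linear.

Lemma free_lift_word w : free_lift (free_word k w) = word_eval w.
Proof.
have [->|w1] := eqVneq w 1%M; last by rewrite /free_lift val_free_word ?lextU.
by rewrite free_word1 linear0 /word_eval fm1.
Qed.

Lemma free_liftM : {morph free_lift : p q / p ** q}.
Proof.
elim/free_alg_ind => [q|p p' IHp IHp' q|c p IHp q|a a1].
- by rewrite nmul0r linear0 nmul0r.
- by rewrite nmulDl !linearD /= IHp IHp' nmulDl.
- by rewrite nmulZl !linearZ /= IHp nmulZl.
elim/free_alg_ind => [|q q' IHq IHq'|c q IHq|b b1].
- by rewrite nmulr0 linear0 nmulr0.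
- by rewrite nmulDr !linearD /= IHq IHq' nmulDr.
- by rewrite nmulZr !linearZ /= IHq nmulZr.
rewrite -(free_wordM k a1 b1) [LHS]free_lift_word (word_evalM a1 b1).
by congr (_ ** _); apply/esym/free_lift_word.
Qed.

Definition lmulw a z := if a == 1%M then z else word_eval a ** z.
Definition rmulw b z := if b == 1%M then z else z ** word_eval b.

Fact lmulw_is_linear a : linear (lmulw a).
Proof.
by move=> c x y; rewrite /lmulw; case: eqP => // _; rewrite nmulDr nmulZr.
Qed.
HB.instance Definition _ a :=
  GRing.isLinear.Build k A A _ (lmulw a) (lmulw_is_linear a).

Fact rmulw_is_linear b : linear (rmulw b).
Proof.
by move=> c x y; rewrite /rmulw; case: eqP => // _; rewrite nmulDl nmulZl.
Qed.
HB.instance Definition _ b :=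
  GRing.isLinear.Build k A A _ (rmulw b) (rmulw_is_linear b).

End FreeLift.

Lemma free_linear_ext (k : fieldType) (Y : choiceType) (V : lmodType k)
    (F G : {linear free_alg k Y -> V}) :
  (forall w, w != 1%M -> F (free_word k w) = G (free_word k w)) -> F =1 G.
Proof.
move=> FG; elim/free_alg_ind => // [|p q Fp Fq|c p Fp].
  by rewrite !linear0.
  by rewrite !linearD Fp Fq.
by rewrite !linearZ Fp.
Qed.

Lemma free_lift_unique (k : fieldType) (Y : choiceType) (A : nalgType k)
    (e : Y -> A) (F : {linear free_alg k Y -> A}) :
    {morph F : p q / p ** q} ->
    (forall y, F (free_word k (letter y)) = e y) ->
  F =1 free_lift e.
Proof.
move=> FM Fe; apply: free_linear_ext => w w1 /=; rewrite free_lift_word.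
elim/nonempty_word_ind: w / w1 => [y|y w w1 IHw]; first exact: Fe.
have y1 := letter_neq1 y.
rewrite (free_wordM k y1 w1) [LHS]FM [RHS](word_evalM _ y1 w1) Fe.
by congr (_ ** _).
Qed.

(** * Two-sided multiples by possibly empty words *)

Section Sandwich.
Variables (k : fieldType) (Y : choiceType).
Implicit Types (a b : {fmonom Y}) (p : free_alg k Y).

Definition letters (y : Y) : free_alg k Y := free_word k (letter y).

Lemma word_eval_letters w : w != 1%M -> word_eval letters w = free_word k w.
Proof.
elim/nonempty_word_ind => [y|y w' w1 IHw]; first by [].
have y1 := letter_neq1 y.
by rewrite (word_evalM _ y1 w1) IHw (free_wordM k y1 w1).
Qed.

(* [sandwich a b p] is the product [a p b]; [a] and [b] may be empty. *)
Definition sandwich a b p : free_alg k Y :=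
  rmulw letters b (lmulw letters a p).

Fact sandwich_is_linear a b : linear (sandwich a b).
Proof. by move=> c p q; rewrite /sandwich !linearP. Qed.
HB.instance Definition _ a b := GRing.isLinear.Build k _ _ _
  (sandwich a b) (sandwich_is_linear a b).

(** Moves computations with two-sided multiples into the algebra with identity, where the ring laws
    hold uniformly, the empty word included. *)
Lemma val_sandwich a b p : val (sandwich a b p) = << a >> * val p * << b >>.
Proof.
have -> : << a >> * val p = val (lmulw letters a p).
  rewrite /lmulw; case: eqVneq => [->|a1]; first exact: mul1r.
  by rewrite (word_eval_letters a1) -(val_free_word k a1).
rewrite /sandwich /rmulw; case: eqVneq => [->|b1]; first by rewrite [RHS]mulr1.
by rewrite (word_eval_letters b1) -(val_free_word k b1).
Qed.

Lemma free_lift_sandwich (A : nalgType k) (e : Y -> A) a p b :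
  free_lift e (sandwich a b p) = rmulw e b (lmulw e a (free_lift e p)).
Proof.
rewrite /sandwich /lmulw /rmulw.
case: eqVneq => [_|b1]; case: eqVneq => [_|a1].
- by [].
- by rewrite free_liftM (word_eval_letters a1) free_lift_word.
- by rewrite free_liftM (word_eval_letters b1) free_lift_word.
rewrite !free_liftM (word_eval_letters a1) (word_eval_letters b1).
by rewrite !free_lift_word.
Qed.

Lemma sandwich_word a u b : u != 1%M ->
  sandwich a b (free_word k u) = free_word k (a * u * b)%M.
Proof.
move=> u1; have aub1 : (a * u * b)%M != 1%M.
  by rewrite !fmM_eq1 (negbTE u1) andbF.
apply: val_inj; rewrite val_sandwich (val_free_word k aub1) -!malgUM.
by rewrite (val_free_word k u1).
Qed.

Lemma sandwich_comp a a' p b b' :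
  sandwich a b' (sandwich a' b p) = sandwich (a * a')%M (b * b')%M p.
Proof.
apply: val_inj; rewrite !val_sandwich -!malgUM; exact: mulr_sandwich.
Qed.

Lemma sandwich11 p : sandwich 1%M 1%M p = p.
Proof. by rewrite /sandwich /lmulw /rmulw eqxx. Qed.

End Sandwich.

Definition linear_of (k : fieldType) (U V : lmodType k) (h : U -> V)
    (h_lin : linear h) : {linear U -> V} :=
  HB.pack_for {linear U -> V} h (GRing.isLinear.Build k U V _ h h_lin).

(** * Quotients, presentations and exact sequences *)

Lemma inj_surj_bij (A B : Type) (h : A -> B) :
  injective h -> (forall y, exists x, h x = y) -> bijective h.
Proof.
move=> h_inj h_surj; pose g y := projT1 (cid (h_surj y)).
have gK : cancel g h by move=> y; rewrite /g; case: cid.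
by exists g => // x; apply: h_inj; rewrite gK.
Qed.

Section KernelIdeal.
Variables (k : fieldType) (A C : nalgType k) (h : {linear A -> C}).
Hypothesis hM : {morph h : x y / x ** y}.

Definition kernel_ideal : ideal A.
Proof.
apply: (@Ideal k A (fun x => h x = 0)).
- exact: linear0.
- by move=> x y hx hy; rewrite linearD hx hy addr0.
- by move=> c x hx; rewrite linearZ /= hx scaler0.
- by move=> x y hy; rewrite hM hy nmulr0.
- by move=> x y hx; rewrite hM hx nmul0r.
Defined.

End KernelIdeal.

Section QuotientTheory.
Variables (k : fieldType) (A : nalgType k) (N : ideal A).

Fact quot_pi_is_linear : linear (quot_pi N).
Proof. by move=> c x y; rewrite quot_piD -quot_scale_pi. Qed.
HB.instance Definition _ :=
  GRing.isLinear.Build k A (quot_alg N) _ (quot_pi N) quot_pi_is_linear.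

Lemma quot_piM : {morph quot_pi N : x y / x ** y}.
Proof. by move=> x y; rewrite -quot_mul_pi. Qed.

Lemma quot_pi_eq0 x : quot_pi N x = 0 <-> N x.
Proof. by rewrite -(linear0 (quot_pi N)) quot_piP subr0. Qed.

Lemma quot_lift (C : nalgType k) (h : {linear A -> C}) :
    {morph h : x y / x ** y} -> (forall x, N x -> h x = 0) ->
  exists h' : {linear quot_alg N -> C},
    {morph h' : x y / x ** y} /\ forall x, h' (quot_pi N x) = h x.
Proof.
move=> hM hN; pose h' (z : quot_alg N) : C := h (repr z).
have h'_pi x : h' (quot_pi N x) = h x.
  apply/eqP; rewrite /h' -subr_eq0 -linearB; apply/eqP/hN/quot_piP.
  by rewrite quot_piK.
have h'_lin : linear h'.
  move=> c x y; rewrite -[x]quot_piK -[y]quot_piK -linearP !h'_pi.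
  exact: linearP.
exists (linear_of h'_lin); split=> //= x y.
by rewrite -[x]quot_piK -[y]quot_piK -quot_piM !h'_pi hM.
Qed.

End QuotientTheory.

Section Presented.
Variables (k : fieldType) (Y : choiceType) (S : free_alg k Y -> Prop).

HB.instance Definition _ := GRing.Linear.copy (class S) (quot_pi (gen_ideal S)).

Lemma classM : {morph class S : p q / p ** q}.
Proof. exact: quot_piM. Qed.

Lemma class_surj (z : presented S) : exists p, class S p = z.
Proof. by exists (repr z); apply: quot_piK. Qed.

Lemma class_eq0 p : class S p = 0 <-> gen_ideal S p.
Proof. exact: quot_pi_eq0. Qed.

Lemma class_rel p : S p -> class S p = 0.
Proof. by move=> Sp; apply/class_eq0 => N; apply. Qed.

Lemma classE p :
  class S p = free_lift (fun y => class S (free_word k (letter y))) p.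
Proof. exact: (free_lift_unique classM). Qed.

(** The relations lie in the kernel of [free_lift e], which is an ideal and so contains the ideal
    they generate. *)
Lemma presented_lift (C : nalgType k) (e : Y -> C) :
    (forall p, S p -> free_lift e p = 0) ->
  exists h : {linear presented S -> C},
    {morph h : x y / x ** y} /\ forall p, h (class S p) = free_lift e p.
Proof.
move=> eS.
apply: (quot_lift (free_liftM e)) => p Np.
exact: (Np (kernel_ideal (free_liftM e))).
Qed.

End Presented.

(** Passage to exact sequences. In the converse direction the kernel of [p] is the ideal, and its
    identification with [M] is multiplicative because both products vanish. *)
Lemma is_extensionP (k : fieldType) (M B E : nalgType k) :
    (forall x y : M, x ** y = 0) ->
  is_extension_of M B E <->
  exists (i : {linear M -> E}) (p : {linear E -> B}),
    [/\ injective i, forall v w, i v ** i w = 0,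
        {morph p : x y / x ** y}, forall b, exists e, p e = b
      & forall e, p e = 0 <-> exists v, e = i v].
Proof.
move=> M2; split.
  move=> [N [[g [gM [g' gK g'K]]] [h [hM [h' hK h'K]]]]].
  have g'lin : linear (fun v => val (g' v)).
    move=> c x y; rewrite -linearP; congr val; apply: (can_inj gK).
    by rewrite linearP !g'K.
  have plin : linear (fun e => h (quot_pi N e)).
    by move=> c x y; rewrite !linearP.
  exists (linear_of g'lin).
  exists (linear_of plin).
  split=> /=.
  - by move=> v w /val_inj/(can_inj g'K).
  - move=> v w; rewrite -[X in X = 0]/(val (g' v ** g' w)).
    have -> : g' v ** g' w = 0; last exact: linear0.
    by apply: (can_inj gK); rewrite gM !g'K M2 linear0.
  - by move=> x y; rewrite quot_piM hM.
  - by move=> b; exists (repr (h' b)); rewrite quot_piK h'K.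
  move=> e; split=> [he|[v ->]]; last first.
    rewrite (_ : quot_pi N _ = 0) ?linear0 //; apply/quot_pi_eq0.
    exact/ideal_predP/valP.
  have /quot_pi_eq0/ideal_predP Ne : quot_pi N e = 0.
    by apply: (can_inj hK); rewrite he linear0.
  by exists (g (IdealAlg Ne)); rewrite gK.
move=> [i [p [i_inj i2 pM p_surj p_ker]]].
have [N NP] : exists N : ideal E, forall e, N e <-> p e = 0.
  by exists (kernel_ideal pM).
exists N; split.
  have ex (x : ideal_alg N) : exists v, val x = i v.
    by apply/p_ker/NP; apply/ideal_predP; apply: valP.
  pose g x := projT1 (cid (ex x)).
  have gK x : i (g x) = val x by rewrite /g; case: cid.
  have glin : linear g.
    by move=> c x y; apply: i_inj; rewrite linearP !gK linearP.
  exists (linear_of glin) => /=; split.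
    move=> x y; apply: i_inj; rewrite M2 linear0 gK.
    by rewrite -[LHS]/(val x ** val y) -!gK i2.
  apply: inj_surj_bij => [x y gxy|v]; first by apply: val_inj; rewrite -!gK gxy.
  have Nv : i v \in ideal_pred N by apply/ideal_predP/NP/p_ker; exists v.
  by exists (IdealAlg Nv); apply: i_inj; rewrite gK.
have [h [hM hE]] := quot_lift pM (fun e => proj1 (NP e)).
exists h; split=> //; apply: inj_surj_bij => [x y|b].
  rewrite -[x]quot_piK -[y]quot_piK !hE => hxy; apply/quot_piP/NP.
  by rewrite linearB hxy subrr.
by have [e <-] := p_surj b; exists (quot_pi N e).
Qed.

Lemma word_eval_map (k : fieldType) (Y Z : choiceType) (A : nalgType k)
    (g : Y -> Z) (e : Z -> A) (w : {fmonom Y}) :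
  word_eval e (map_word g w) = word_eval (fun y => e (g y)) w.
Proof. by case: w; rewrite /word_eval /=; elim=> // y [|z s] //= ->. Qed.

Lemma free_lift_map (k : fieldType) (Y Z : choiceType) (A : nalgType k)
    (g : Y -> Z) (e : Z -> A) (p : free_alg k Y) :
  free_lift e (free_map g p) = free_lift (fun y => e (g y)) p.
Proof.
rewrite /free_map linear_sum; apply: eq_bigr => w _.
by rewrite linearZ /= free_lift_word word_eval_map.
Qed.

(** * The universal property of the presented extension *)

Section Basis.
Variables (k : fieldType) (M : lmodType k) (J : choiceType) (m : J -> M).
Hypothesis basis_m : is_basis m.

Definition coord (v : M) : {malg k[J]} := projT1 (cid (basis_m v)).

Lemma coordK v : lincomb m (coord v) = v.
Proof. by rewrite /coord; case: cid => c []. Qed.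

Lemma lincombK c : coord (lincomb m c) = c.
Proof.
have [c' [_ uniq_c']] := basis_m (lincomb m c).
by rewrite -(uniq_c' _ (coordK _)) -(uniq_c' c).
Qed.

Fact coord_is_linear : linear coord.
Proof.
move=> a v w; apply: (can_inj lincombK).
have lextK u : lext m (coord u) = u by apply: coordK.
by rewrite coordK -[RHS]/(lext m _) linearP /= !lextK.
Qed.
HB.instance Definition _ := GRing.isLinear.Build k _ _ _ coord coord_is_linear.

Lemma coord_basis j : coord (m j) = << j >>.
Proof. by rewrite -[m j](lextU m) lincombK. Qed.

Lemma basis_linear_ext (V : lmodType k) (F G : {linear M -> V}) :
  (forall j, F (m j) = G (m j)) -> F =1 G.
Proof.
move=> FG v; rewrite -(coordK v) /lincomb !linear_sum; apply: eq_bigr => j _.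
by rewrite !linearZ FG.
Qed.

End Basis.

Section Bimodule.
Variables (k : fieldType) (B : nalgType k) (M : lmodType k).
Variable K : bimodule B M.

HB.instance Definition _ b :=
  GRing.isLinear.Build k M M _ (lact K b) (lact_linearr K b).
HB.instance Definition _ v :=
  GRing.isLinear.Build k B M _ (ract K v) (ract_linearr K v).

(** The swapped forms carry the linear structure in the other argument of each action. *)
Definition lact_flip v b := lact K b v.
Definition ract_flip b v := ract K v b.

HB.instance Definition _ v :=
  GRing.isLinear.Build k B M _ (lact_flip v) (lact_linearl K v).
HB.instance Definition _ b :=
  GRing.isLinear.Build k M M _ (ract_flip b) (ract_linearl K b).

End Bimodule.

Section ExtensionData.
Variables (k : fieldType) (d : Order.disp_t) (X : orderType d).
Variables (Lam : {fmonom X} -> Prop) (f : {fmonom X} -> free_alg k X).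
Variables (M : lmodType k) (K : bimodule (presented (rels Lam f)) M).
Variables (mu : {fmonom X} -> M).

Local Notation R := (rels Lam f).

(* What is needed to map the presented extension to [A]; see [pres_lift]. *)
Definition ext_data (A : nalgType k) (s : X -> A) (i : {linear M -> A}) :=
  [/\ forall u, Lam u -> free_lift s (free_word k u - f u) = i (mu u),
      forall x v, s x ** i v = i (lact K (class R (letters k x)) v),
      forall v x, i v ** s x = i (ract K v (class R (letters k x)))
    & forall v w, i v ** i w = 0].

Section Data.
Variables (A : nalgType k) (s : X -> A) (i : {linear M -> A}).
Hypothesis si : ext_data s i.

(** By linearity [q] may be taken to be a word; associativity then reduces it to its letters, where
    the claim is part of [ext_data]. *)
Lemma ext_data_lact q v : free_lift s q ** i v = i (lact K (class R q) v).
Proof.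
have [_ sl _ _] := si.
rewrite -[lact K _ _]/(lact_flip K v _).
elim/free_alg_ind: q => [|p q IHp IHq|c p IHp|w].
- by rewrite !linear0 nmul0r.
- by rewrite !linearD nmulDl /= IHp IHq.
- by rewrite !linearZ nmulZl /= IHp.
move=> w1; rewrite free_lift_word /lact_flip.
elim/nonempty_word_ind: w / w1 v => [x v|x w w1 IHw v]; first exact: sl.
rewrite word_evalM ?free_wordM ?letter_neq1 // classM lactM -nmulA IHw.
exact: sl.
Qed.

Lemma ext_data_ract v q : i v ** free_lift s q = i (ract K v (class R q)).
Proof.
have [_ _ sr _] := si.
elim/free_alg_ind: q => [|p q IHp IHq|c p IHp|w].
- by rewrite !linear0 nmulr0.
- by rewrite !linearD nmulDr /= IHp IHq.
- by rewrite !linearZ nmulZr /= IHp.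
move=> w1; rewrite free_lift_word.
elim/nonempty_word_ind: w / w1 v => [x v|x w w1 IHw v]; first exact: sr.
by rewrite word_evalM ?free_wordM ?letter_neq1 // classM ractM nmulA -IHw sr.
Qed.

(** By the two preceding lemmas the elements sent into the image of [i] form an ideal, and this
    ideal contains every relator. *)
Lemma ext_data_ideal q : gen_ideal R q -> exists v, free_lift s q = i v.
Proof.
have [rel_s _ _ _] := si.
have [N NP] : exists N : ideal (free_alg k X),
    forall q, N q <-> exists v, free_lift s q = i v.
  unshelve eexists.
    apply: (@Ideal _ _ (fun q => exists v, free_lift s q = i v)).
    - by exists 0; rewrite !linear0.
    - move=> p p' [v pv] [v' pv']; exists (v + v').
      by rewrite !linearD /= pv pv'.
    - by move=> c p [v pv]; exists (c *: v); rewrite !linearZ /= pv.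
    - by move=> p p' [v pv]; eexists; rewrite free_liftM pv ext_data_lact.
    - by move=> p p' [v pv]; eexists; rewrite free_liftM pv ext_data_ract.
  by [].
move=> /(_ N) Nq; apply/NP/Nq => _ [u Lu ->]; apply/NP; exists (mu u).
exact: rel_s.
Qed.

End Data.

Variables (J : choiceType) (m : J -> M).
Hypothesis basis_m : is_basis m.

Local Notation S1 := (ext_rels K m Lam f mu).
Local Notation P := (presented S1).

Definition pres_x (x : X) : P := class S1 (free_word k (gen_x J x)).
Definition pres_m (v : M) : P :=
  class S1 (lext (fun j => free_word k (gen_m X j)) (coord basis_m v)).

Fact pres_m_is_linear : linear pres_m.
Proof. by move=> c v w; rewrite /pres_m !linearP. Qed.
HB.instance Definition _ :=
  GRing.isLinear.Build k M P _ pres_m pres_m_is_linear.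

Lemma pres_m_basis j : pres_m (m j) = class S1 (free_word k (gen_m X j)).
Proof. by rewrite /pres_m coord_basis lextU. Qed.

Lemma class_free_lin c v :
  lincomb m c = v -> class S1 (free_lin X c) = pres_m v.
Proof. by move=> <-; rewrite /pres_m lincombK. Qed.

Lemma free_lift_pres_x q : free_lift pres_x q = class S1 (free_map inr q).
Proof. by rewrite classE free_lift_map. Qed.

(** Each clause is one family of relations in [S1], extended from the basis to all of [M] by
    linearity. *)
Lemma pres_ext_data : ext_data pres_x pres_m.
Proof.
split.
- move=> u Lu; rewrite linearB /= (free_lift_pres_x (f u)) free_lift_word.
  have := class_rel (Ext_rel K f Lu (coordK basis_m (mu u))).
  rewrite linearB linearD /= (class_free_lin (coordK _ _)) opprD addrA.
  move=> /eqP; rewrite subr_eq0 => /eqP <-; congr (_ - _).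
  by rewrite classE free_lift_word word_eval_map.
- move=> x v; have L1 : linear (fun v => pres_x x ** pres_m v).
    by move=> c v1 v2; rewrite linearP nmulDr nmulZr.
  have L2 : linear (fun v => pres_m (lact K (class R (letters k x)) v)).
    by move=> c v1 v2; rewrite !linearP.
  apply: (basis_linear_ext basis_m (F := linear_of L1) (G := linear_of L2)).
  move=> j /=; rewrite pres_m_basis /pres_x -classM -free_wordM ?letter_neq1 //.
  have cE := coordK basis_m (lact K (class R (letters k x)) (m j)).
  have := class_rel (Ext_left (K := K) Lam f mu cE).
  rewrite linearB /= (class_free_lin (coordK _ _)) => /eqP.
  by rewrite subr_eq0 => /eqP.
- move=> v x; have L1 : linear (fun v => pres_m v ** pres_x x).
    by move=> c v1 v2; rewrite linearP nmulDl nmulZl.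
  have L2 : linear (fun v => pres_m (ract_flip K (class R (letters k x)) v)).
    by move=> c v1 v2; rewrite !linearP.
  apply: (basis_linear_ext basis_m (F := linear_of L1) (G := linear_of L2)).
  move=> j /=; rewrite pres_m_basis /pres_x -classM -free_wordM ?letter_neq1 //.
  have cE := coordK basis_m (ract K (m j) (class R (letters k x))).
  have := class_rel (Ext_right (K := K) Lam f mu cE).
  rewrite linearB /= (class_free_lin (coordK _ _)) => /eqP.
  by rewrite subr_eq0 => /eqP.
move=> v w; have L0 (V : lmodType k) : linear (fun _ : M => 0 : V).
  by move=> c v1 v2; rewrite scaler0 addr0.
have L1 : linear (fun v => pres_m v ** pres_m w).
  by move=> c v1 v2; rewrite linearP nmulDl nmulZl.
apply: (basis_linear_ext basis_m (F := linear_of L1) (G := linear_of (L0 _))).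
move=> j /=; have L2 : linear (fun w => pres_m (m j) ** pres_m w).
  by move=> c v1 v2; rewrite linearP nmulDr nmulZr.
apply: (basis_linear_ext basis_m (F := linear_of L2) (G := linear_of (L0 _))).
move=> l /=; rewrite !pres_m_basis -classM -free_wordM ?letter_neq1 //.
by apply: class_rel; apply: Ext_sq.
Qed.

(** Sums of this form contain the generators and are stable under left multiplication by a
    generator. *)
Lemma pres_decomp z : exists q v, z = free_lift pres_x q + pres_m v.
Proof.
have [_ _ _ mm0] := pres_ext_data.
have [p <-] := class_surj z; elim/free_alg_ind: p => [|p q|c p|w].
- by exists 0, 0; rewrite !linear0 addr0.
- move=> [p1 [v1 E1]] [p2 [v2 E2]]; exists (p1 + p2), (v1 + v2).
  by rewrite !linearD /= E1 E2 addrACA.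
- move=> [p1 [v1 E1]]; exists (c *: p1), (c *: v1).
  by rewrite !linearZ /= E1 scalerDr.
have letter_case y :
    exists q v, class S1 (letters k y) = free_lift pres_x q + pres_m v.
  case: y => [j|x].
    by exists 0, (m j); rewrite linear0 add0r pres_m_basis.
  by exists (letters k x), 0; rewrite linear0 addr0 free_lift_word.
elim/nonempty_word_ind => [//|y w' w1 [q [v IHw]]].
have [q1 [v1 E1]] := letter_case y.
rewrite free_wordM ?letter_neq1 // classM [X in X ** _]E1 IHw.
(* Of the four terms, the product of the two module parts vanishes and both mixed terms stay in the
   image of [pres_m]. *)
rewrite nmulDl !nmulDr mm0 addr0 (ext_data_lact pres_ext_data).
rewrite (ext_data_ract pres_ext_data) -free_liftM -addrA -linearD.
by eexists; eexists; reflexivity.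
Qed.

(** The universal property of the presented extension: [ext_data] says precisely that the relations
    hold in [A]. *)
Lemma pres_lift (A : nalgType k) (s : X -> A) (i : {linear M -> A}) :
    ext_data s i ->
  exists h : {linear P -> A},
    [/\ {morph h : x y / x ** y},
        forall q, h (free_lift pres_x q) = free_lift s q
      & forall v, h (pres_m v) = i v].
Proof.
move=> [rel_s sl sr i2].
pose e y := match y with inl j => i (m j) | inr x => s x end.
have e_lin c : free_lift e (free_lin X c) = i (lincomb m c).
  rewrite /free_lin /lincomb !linear_sum; apply: eq_bigr => j _.
  by rewrite !linearZ /= free_lift_word.
have [|h [hM hE]] := @presented_lift _ _ S1 _ e.
  move=> p []; rewrite ?linearB.
  - move=> u c Lu cE; rewrite linearB linearD /= e_lin cE -(rel_s u Lu).
    rewrite linearB /= free_lift_map !free_lift_word word_eval_map.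
    by rewrite subrKC subrr.
  - move=> x j c cE; rewrite linearB /= e_lin cE -sl free_lift_word.
    by rewrite word_evalM ?letter_neq1 // subrr.
  - move=> j x c cE; rewrite linearB /= e_lin cE -sr free_lift_word.
    by rewrite word_evalM ?letter_neq1 // subrr.
  by move=> j l; rewrite free_lift_word word_evalM ?letter_neq1 //; apply: i2.
exists h; split=> // [q|v]; first by rewrite free_lift_pres_x hE free_lift_map.
by rewrite /pres_m hE -[lext _ _]/(free_lin X _) e_lin coordK.
Qed.

End ExtensionData.

(** * The deg-lex order *)

Section DegLex.
Variables (d : Order.disp_t) (X : orderType d).
Implicit Types (u v w a b : {fmonom X}).

Lemma deglex_le_refl : reflexive (@deglex_le _ X).
Proof. by move=> u; rewrite /deglex_le eqxx lexx orbT. Qed.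

Lemma deglex_le_total : total (@deglex_le _ X).
Proof.
by move=> u v; rewrite /deglex_le; case: ltngtP => //= _; apply: le_total.
Qed.

Lemma deglex_le_trans : transitive (@deglex_le _ X).
Proof.
move=> v u w; rewrite /deglex_le.
case: (ltngtP (size u) (size v)) => //= [uv _|uv uv'].
  case: (ltngtP (size v) (size w)) => //= [vw _|<- _]; last by rewrite uv.
  by rewrite (ltn_trans uv vw).
rewrite uv; case: ltngtP => //= _; exact: le_trans.
Qed.

Lemma lexi_cat2l (r s t : seqlexi X) :
  ((r ++ s : seqlexi X) <= (r ++ t : seqlexi X))%O = (s <= t)%O.
Proof. by elim: r => //= x r IHr; rewrite eqhead_lexiE. Qed.

Lemma lexi_cat2r (r s t : seqlexi X) : size s = size t ->
  ((s ++ r : seqlexi X) <= (t ++ r : seqlexi X))%O = (s <= t)%O.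
Proof.
elim: s t => [|x s IHs] [|y t] //=; first by rewrite !lexx.
by case=> /IHs st; rewrite !lexi_cons st.
Qed.

Lemma deglex_ltM a b u v :
  deglex_lt u v -> deglex_lt (a * u * b)%M (a * v * b)%M.
Proof.
case/andP=> uv le_uv; apply/andP; split.
  apply: contra uv; rewrite !fmP !fmM => /eqP E; apply/eqP.
  (* The suffix [b] is cancelled on the reversed words, then the prefix [a] on the words
     themselves. *)
  have : rev ((a ++ u) ++ b) = rev ((a ++ v) ++ b) by rewrite E.
  rewrite !rev_cat => /(congr1 (drop (size (rev b)))).
  rewrite !drop_size_cat // => /(congr1 rev); rewrite !rev_cat !revK.
  by move/(congr1 (drop (size a))); rewrite !drop_size_cat.
move: le_uv; rewrite /deglex_le !fmM !size_cat.
rewrite ltn_add2r ltn_add2l eqn_add2r eqn_add2l.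
case: ltngtP => //= uv_size; rewrite lexi_cat2r ?lexi_cat2l //.
by rewrite !size_cat uv_size.
Qed.

Hypothesis wfX : well_founded (fun x y : X => (x < y)%O).

Let lex_lt (s t : seq X) : Prop :=
  size s = size t /\ ((s : seqlexi X) < (t : seqlexi X))%O.

(** Nested induction on the length, the first letter and the tail. Equal lengths matter: for letters
    a < b, the chain b > ab > aab > ... of the plain lexicographic order never stops. *)
Lemma lex_lt_wf : well_founded lex_lt.
Proof.
have IH n (s : seq X) : size s = n -> Acc lex_lt s.
  elim: n s => [|n IHn].
    case=> [_|x s]; last by [].
    by apply: Acc_intro => t [_]; rewrite ltxis0.
  case=> [|x s] sn; first by [].
  case: sn; elim/(well_founded_ind wfX): x s => x IHx s sn.
  have acc_s := IHn s sn; elim: acc_s sn => {}s _ IHs sn.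
  apply: Acc_intro => -[|y t] [ts]; first by [].
  case: ts => ts; rewrite ltxi_cons => /andP[].
  rewrite le_eqVlt => /predU1P[->|yx _]; last by apply: IHx; rewrite ?ts.
  by rewrite lexx => st; apply: IHs; rewrite ?ts.
by move=> s; apply: IH.
Qed.

(** The outer induction, on a bound for the length, settles shorter words; words of equal length are
    settled by [lex_lt_wf]. *)
Lemma deglex_lt_wf : well_founded (@deglex_lt _ X).
Proof.
have IH n : forall w, (size w < n)%N -> Acc (@deglex_lt _ X) w.
  elim: n => [w|n IHn [s]]; first by rewrite ltn0.
  elim/(well_founded_ind lex_lt_wf): s => s IHs sn.
  apply: Acc_intro => -[t] /andP[ts]; rewrite /deglex_le.
  case: ltngtP => [lt_ts _|//|eq_ts /= le_ts].
    by apply: IHn; apply: leq_trans lt_ts _.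
  apply: IHs; last by rewrite /= eq_ts.
  split=> //; rewrite lt_neqAle [(_ <= _)%O]le_ts andbT.
  by apply: contra ts => /eqP->.
by move=> w; apply: (IH (size w).+1).
Qed.

End DegLex.

Lemma lead_max (k : fieldType) (d : Order.disp_t) (X : orderType d)
    (p : {malg k[{fmonom X}]}) w :
  w \in msupp p -> deglex_le w (lead p).
Proof.
have le_big (s : seq {fmonom X}) : w \in s ->
    deglex_le w
      (\big[(fun u v => if deglex_le u v then v else u)/1%M]_(v <- s) v).
  elim: s => //= v s IHs; rewrite inE big_cons; set b := \big[_/_]_(_ <- _) _.
  move=> /predU1P[->|/IHs le_w]; case: ifPn => // nle.
    exact: deglex_le_refl.
  apply: deglex_le_trans le_w _.
  by have := deglex_le_total v b; rewrite (negbTE nle).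
exact: le_big.
Qed.

(** * The normalization map *)

Lemma lext_eq_in (k : fieldType) (K : choiceType) (V : lmodType k)
    (g g' : K -> V) (c : {malg k[K]}) :
  {in msupp c, g =1 g'} -> lext g c = lext g' c.
Proof. by move=> gg'; apply: eq_big_seq => w /gg' ->. Qed.

Lemma linear_lext (k : fieldType) (K : choiceType) (V W : lmodType k)
    (L : {linear V -> W}) (g : K -> V) (c : {malg k[K]}) :
  L (lext g c) = lext (L \o g) c.
Proof. by rewrite linear_sum; apply: eq_bigr => w _; rewrite linearZ. Qed.

Lemma mul_lext (k : fieldType) (K : monomType) (p q r : {malg k[K]}) :
  p * q * r = lext (fun w => p * << w >> * r) q.
Proof.
rewrite {1}(malgE_lext q) /lext mulr_sumr mulr_suml; apply: eq_bigr => w _.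
by rewrite malg_scaleAr -scalerAl.
Qed.

(** Well-founded recursion through a linear combination. The test inside [F] provides the proof of
    descent that [Fix] asks for; on the support of [g w] it always succeeds. *)
Lemma wf_lext_rec (k : fieldType) (K : choiceType) (V : lmodType k)
    (lt : rel K) (v0 : K -> V) (g : K -> {malg k[K]}) :
    well_founded lt -> (forall w w', w' \in msupp (g w) -> lt w' w) ->
  exists N : K -> V, forall w, N w = v0 w + lext N (g w).
Proof.
move=> lt_wf g_lt.
pose F w (rec : forall w', lt w' w -> V) := v0 w + lext (fun w' =>
  if pselect (lt w' w) is left w'w then rec w' w'w else 0) (g w).
exists (Fix lt_wf _ F) => w; rewrite Fix_eq; last first.
  move=> {}w r r' rr'; congr (_ + _); apply: lext_eq_in => w' _.
  by case: pselect.
by congr (_ + _); apply: lext_eq_in => w' /g_lt w'w; case: pselect.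
Qed.

(** Levi's lemma for the free monoid. *)
Lemma word_cat_split (Y : choiceType) (a b p q : {fmonom Y}) :
    (a * p = b * q)%M -> (size a <= size b)%N ->
  exists e, b = (a * e)%M /\ p = (e * q)%M.
Proof.
move=> E ab; exists (FMonom (drop (size a) b)).
have {}E : a ++ p = b ++ q by rewrite -!fmM E.
have Eb : b = a ++ drop (size a) b :> seq Y.
  have := congr1 (take (size a)) E.
  by rewrite take_size_cat // takel_cat // => ta; rewrite {1}ta cat_take_drop.
split; apply/eqP; rewrite fmP fmM; first exact/eqP.
by move: E; rewrite {1}Eb -catA => /eqP; rewrite eqseq_cat // => /andP[].
Qed.

Lemma size_word_eq0 (Y : choiceType) (w : {fmonom Y}) :
  (size w == 0%N) = (w == 1%M).
Proof. by rewrite fmP fm1 size_eq0. Qed.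

(** * Actions of words on the bimodule *)

Section WordActionTheory.
Variables (k : fieldType) (X : choiceType) (S : free_alg k X -> Prop).
Variables (M : lmodType k) (K : bimodule (presented S) M).
Implicit Types (a b c w : {fmonom X}) (v : M).

Lemma lact_word_neq1 w v :
  w != 1%M -> lact_word K w v = lact K (class S (free_word k w)) v.
Proof. by move=> w1; rewrite /lact_word (negbTE w1). Qed.

Lemma ract_word_neq1 v w :
  w != 1%M -> ract_word K v w = ract K v (class S (free_word k w)).
Proof. by move=> w1; rewrite /ract_word (negbTE w1). Qed.

Fact lact_word_is_linear a : linear (lact_word K a).
Proof.
by move=> c v w; rewrite /lact_word; case: eqP => // _; rewrite linearP.
Qed.
HB.instance Definition _ a :=
  GRing.isLinear.Build k M M _ (lact_word K a) (lact_word_is_linear a).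

(* Locked because unifying two actions of distinct words is very slow. *)
Fact act_key : unit. Proof. exact: tt. Qed.
Definition act := locked_with act_key
  (fun a b v => ract_word K (lact_word K a v) b : M).

Lemma actE a b v : act a b v = ract_word K (lact_word K a v) b.
Proof. by rewrite /act unlock. Qed.

Fact act_is_linear a b : linear (act a b).
Proof.
move=> c v w; rewrite !actE /ract_word; case: eqP => _; first exact: linearP.
rewrite linearP -[LHS]/(ract_flip K _ _); exact: linearP.
Qed.
HB.instance Definition _ a b :=
  GRing.isLinear.Build k M M _ (act a b) (act_is_linear a b).

Lemma lact_wordM a b v :
  lact_word K (a * b)%M v = lact_word K a (lact_word K b v).
Proof.
rewrite /lact_word fmM_eq1; case: eqVneq => [->|a1] /=; first by rewrite mul1m.
case: eqVneq => [->|b1] /=; first by rewrite mulm1.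
by rewrite free_wordM // classM lactM.
Qed.

Lemma ract_wordM a b v :
  ract_word K v (a * b)%M = ract_word K (ract_word K v a) b.
Proof.
rewrite /ract_word fmM_eq1; case: eqVneq => [->|a1] /=; first by rewrite mul1m.
case: eqVneq => [->|b1] /=; first by rewrite mulm1.
by rewrite free_wordM // classM ractM.
Qed.

Lemma lract_wordA a b v :
  ract_word K (lact_word K a v) b = lact_word K a (ract_word K v b).
Proof.
rewrite /ract_word /lact_word; case: eqP => _; case: eqP => _ //.
by rewrite lractA.
Qed.

Lemma act_comp a a' b b' v :
  act a b (act a' b' v) = act (a * a')%M (b' * b)%M v.
Proof. by rewrite !actE lact_wordM ract_wordM -lract_wordA. Qed.

Lemma act11 v : act 1%M 1%M v = v.
Proof. by rewrite actE /ract_word /lact_word !eqxx. Qed.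

Lemma lact_wordE a v : lact_word K a v = act a 1%M v.
Proof. by rewrite actE /ract_word eqxx. Qed.

Lemma ract_wordE b v : ract_word K v b = act 1%M b v.
Proof. by rewrite actE /lact_word eqxx. Qed.

(** The empty word acts as the identity on the right-hand side, but its coefficient in [p] is
    zero. *)
Lemma lact_class p v :
  lact K (class S p) v = lext (fun w => act w 1%M v) (val p).
Proof.
have L1 : linear (fun p => lact_flip K v (class S p)).
  by move=> c q r; rewrite !linearP.
have L2 : linear (fun p : free_alg k X => lext (fun w => act w 1%M v) (val p)).
  by move=> c q r; rewrite !linearP.
apply: (free_linear_ext (F := linear_of L1) (G := linear_of L2)) => w w1 /=.
rewrite -[free_val _]/(val _) val_free_word // lextU -lact_wordE.
by rewrite lact_word_neq1.
Qed.

Lemma ract_class p v :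
  ract K v (class S p) = lext (fun w => act 1%M w v) (val p).
Proof.
have L1 : linear (fun p => ract K v (class S p)).
  by move=> c q r; rewrite !linearP.
have L2 : linear (fun p : free_alg k X => lext (fun w => act 1%M w v) (val p)).
  by move=> c q r; rewrite !linearP.
apply: (free_linear_ext (F := linear_of L1) (G := linear_of L2)) => w w1 /=.
rewrite -[free_val _]/(val _) val_free_word // lextU -ract_wordE.
by rewrite ract_word_neq1.
Qed.

Lemma act_lext_l a b c p v :
  lext (fun w => act (a * w * c)%M b v) (val p)
  = act a b (lact K (class S p) (act c 1%M v)).
Proof.
rewrite lact_class linear_lext; apply: lext_eq_in => w _ /=.
by rewrite !act_comp !mul1m ?mulmA.
Qed.

Lemma act_lext_r a b c p v :
  lext (fun w => act a (c * w * b)%M v) (val p)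
  = act a b (ract K (act 1%M c v) (class S p)).
Proof.
rewrite ract_class linear_lext; apply: lext_eq_in => w _ /=.
by rewrite !act_comp !mulm1 ?mulmA.
Qed.

End WordActionTheory.

(** * Identities for overlapping and disjoint relators *)

Lemma sub_exchange (V : zmodType) (x y a b : V) :
  x - y = a - b -> x - a = y - b.
Proof.
move=> /eqP; rewrite subr_eq => /eqP ->.
by rewrite addrC !addrA addNr add0r addrC.
Qed.

Section Compositions.
Variable A : pzRingType.

Lemma mulrA4 (x c w b : A) : x * (c * w * b) = x * c * w * b.
Proof. by rewrite !mulrA. Qed.

(** With [h + f] in the role of the leading word, the terms containing both [h1] and [h2] cancel. *)
Lemma disjoint_composition (a h1 f1 c h2 f2 b : A) :
  a * h1 * (c * (h2 + f2) * b) - a * (h1 + f1) * c * h2 * b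
  = a * h1 * c * f2 * b - a * f1 * (c * h2 * b).
Proof. by rewrite !(mulrDl, mulrDr) !mulrA opprD addrACA subrr add0r. Qed.

Lemma overlap_difference (f1 f2 u1 u2 c e : A) : u1 * c = e * u2 ->
  (u1 - f1) * c - e * (u2 - f2) = e * f2 - f1 * c.
Proof. by move=> E; rewrite mulrBl mulrBr E opprB addrC addrA subrK. Qed.

Lemma overlap_composition (a b f1 f2 u1 u2 c e : A) : u1 * c = e * u2 ->
  a * (u1 - f1) * (c * b) - a * e * (u2 - f2) * b = a * (e * f2 - f1 * c) * b.
Proof.
move=> E; rewrite !mulrA -mulrBl -[a * _ * c]mulrA -[a * e * _]mulrA -mulrBr.
by rewrite overlap_difference.
Qed.

End Compositions.

Section SandwichWord.
Variables (k : fieldType) (Y : choiceType).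
Implicit Types (a b c w : {fmonom Y}) (p : free_alg k Y).

(** This shape isolates the word [w], as needed to expand along a polynomial with [mul_lext]. *)
Lemma val_sandwich_r a b c w p :
  val (sandwich a (c * w * b)%M p)
  = << a >> * val p * << c >> * << w >> * << b >>.
Proof. by rewrite val_sandwich -!malgUM; apply: mulrA4. Qed.

Lemma val_sandwich_l a b c w p :
  val (sandwich (a * w * c)%M b p)
  = << a >> * << w >> * (<< c >> * val p * << b >>).
Proof. by rewrite val_sandwich -!malgUM; apply/esym/mulrA4. Qed.

End SandwichWord.

(** * Construction and confluence of the normalization map *)

Section Normalization.
Variables (k : fieldType) (d : Order.disp_t) (X : orderType d).
Hypothesis wfX : well_founded (fun x y : X => (x < y)%O).
Variables (Lam : {fmonom X} -> Prop) (f : {fmonom X} -> free_alg k X).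
Hypothesis Lam_nonempty : forall u, Lam u -> u != 1%M.

Let h u : free_alg k X := free_word k u - f u.

Hypothesis lead_h : forall u, Lam u -> lead (val (h u)) = u.
Hypothesis monic_h : forall u, Lam u -> Defs.monic (val (h u)).
Hypothesis min_R : GS_minimal (rels Lam f).

Lemma val_relator u : Lam u -> val (h u) = << u >> - val (f u).
Proof. by move/Lam_nonempty; apply: val_free_wordB. Qed.

(** As [h u] is monic with leading word [u], the coefficient of [u] in [f u] is zero; every other
    word of [f u] survives in [h u], hence is at most its leading word. *)
Lemma relator_tail_lt u w : Lam u -> w \in msupp (val (f u)) -> deglex_lt w u.
Proof.
move=> Lu wf; have u1 := Lam_nonempty Lu.
have hE w' : (val (h u))@_w' = (u == w')%:R - (val (f u))@_w'.
  by rewrite val_relator // mcoeffB mcoeffU1.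
have wu : w != u.
  apply: contraTneq wf => ->; rewrite -mcoeff_eq0.
  have := monic_h Lu; rewrite /Defs.monic lead_h // hE eqxx => /eqP.
  by rewrite subr_eq addrC -subr_eq subrr eq_sym.
rewrite /deglex_lt wu -(lead_h Lu); apply: lead_max.
rewrite -mcoeff_neq0 hE (eq_sym u) (negbTE wu) sub0r oppr_eq0 mcoeff_neq0.
exact: wf.
Qed.

(** Minimality speaks of distinct relators; distinct words give distinct relators because their
    leading words differ. *)
Lemma relator_infix u u' : Lam u -> Lam u' -> infix u u' -> u = u'.
Proof.
move=> Lu Lu'; apply: contraTeq => neq_uu'.
have neq_h : h u <> h u'.
  by move=> E; move: neq_uu'; rewrite -(lead_h Lu) -(lead_h Lu') E eqxx.
have Rh v : Lam v -> rels Lam f (h v) by exists v.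
have := min_R (Rh _ Lu) (Rh _ Lu') neq_h.
by rewrite !lead_h.
Qed.

Variables (M : lmodType k) (K : bimodule (presented (rels Lam f)) M).
Variable mu : {fmonom X} -> M.

Variable expr : {fmonom X} -> {fmonom X} -> {fmonom X} ->
  seq (k * {fmonom X} * {fmonom X} * {fmonom X}).
Hypothesis exprP : forall u1 u2 c dw, overlap Lam u1 u2 c dw ->
  expresses Lam f u1 u2 c dw (expr u1 u2 (u1 * c)%M).
Hypothesis g0 : forall u1 u2 c dw, overlap Lam u1 u2 c dw ->
  g_elt K mu u1 u2 c dw (expr u1 u2 (u1 * c)%M) = 0.

(** The relator [h u] is zero in the presented algebra, so replacing [u] by [f u] inside an acting
    word changes nothing. *)
Lemma act_relator_l a b c v u : Lam u ->
  lext (fun w => act K (a * w * c)%M b v) (val (f u)) = act K (a * u * c)%M b v.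
Proof.
move=> Lu; apply/esym/eqP; rewrite -subr_eq0.
rewrite -(lextU (fun w => act K (a * w * c)%M b v) u).
rewrite -linearB /= -val_relator // act_lext_l.
rewrite class_rel; last by exists u.
by rewrite -[lact K _ _]/(lact_flip K _ _) !linear0.
Qed.

Lemma act_relator_r a b c v u : Lam u ->
  lext (fun w => act K a (c * w * b)%M v) (val (f u)) = act K a (c * u * b)%M v.
Proof.
move=> Lu; apply/esym/eqP; rewrite -subr_eq0.
rewrite -(lextU (fun w => act K a (c * w * b)%M v) u).
rewrite -linearB /= -val_relator // act_lext_r.
by rewrite class_rel ?linear0; last by exists u.
Qed.

Definition decomposes (t : {fmonom X} * {fmonom X} * {fmonom X}) w :=
  Lam t.1.2 /\ w = (t.1.1 * t.1.2 * t.2)%M.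

Lemma val_sandwich_relator a b u : Lam u ->
  val (sandwich a b (h u)) = << (a * u * b)%M >> - val (sandwich a b (f u)).
Proof.
move=> Lu; have u1 := Lam_nonempty Lu.
rewrite /h !linearB /= sandwich_word // -[free_val _]/(val _) val_free_word //.
by rewrite !fmM_eq1 (negbTE u1) andbF.
Qed.

Lemma sandwich_supp a b (p : free_alg k X) w :
    w \in msupp (val (sandwich a b p)) ->
  exists2 w', w' \in msupp (val p) & w = (a * w' * b)%M.
Proof.
rewrite val_sandwich mul_lext /lext => wp.
have [[w' w'p ->]|none] :=
  pselect (exists2 w', w' \in msupp (val p) & w = (a * w' * b)%M).
  by exists w'.
move: wp; rewrite -mcoeff_neq0 raddf_sum big_seq big1 ?eqxx //= => w' w'p.
rewrite mcoeffZ !malgUM mcoeffU1; case: eqP => [E|_]; last by rewrite mulr0.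
by case: none; exists w'.
Qed.

(* Only one decomposition of each reducible word is prescribed here. *)
Lemma normalization_exists : exists nu : {fmonom X} -> M,
  forall w t0, decomposes t0 w -> exists t, decomposes t w /\
    lext nu (val (sandwich t.1.1 t.2 (h t.1.2))) = act K t.1.1 t.2 (mu t.1.2).
Proof.
pose red w := exists t, decomposes t w.
(* The recursion is nu(w) = a (u) b + nu(a f_u b) for the chosen decomposition w = a u b, and nu(w)
   = 0 when w is irreducible. *)
pose v0 w := if pselect (red w) is left r then
  let t := projT1 (cid r) in act K t.1.1 t.2 (mu t.1.2) else 0.
pose g w := if pselect (red w) is left r then
  let t := projT1 (cid r) in val (sandwich t.1.1 t.2 (f t.1.2)) else 0.
have [|nu nuE] := @wf_lext_rec _ _ _ (@deglex_lt _ X) v0 g (deglex_lt_wf wfX).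
  move=> w w'; rewrite /g; case: pselect => [r|]; last by rewrite msupp0.
  case: (cid r) => -[[a u] b] /= [Lu ->] /sandwich_supp[w1 w1f ->].
  by apply: deglex_ltM; apply: relator_tail_lt.
exists nu => w t0 tw; have red_w : red w by exists t0.
have := nuE w; rewrite /v0 /g; case: pselect => // r.
case: (cid r) => -[[a u] b] /= [/= Lu wE] nuw; exists (a, u, b); split=> //=.
rewrite -[free_val _]/(val _) val_sandwich_relator // linearB /= lextU -wE.
by rewrite nuw addrK.
Qed.

Section LocalConfluence.
Variables (nu : {fmonom X} -> M) (w : {fmonom X}).
Hypothesis IH : forall a b u, Lam u -> deglex_lt (a * u * b)%M w ->
  lext nu (val (sandwich a b (h u))) = act K a b (mu u).

(** The error of the desired formula at one decomposition. Since some decomposition of [w] has error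
    zero, it is enough that all decompositions of [w] have the same error. *)
Let defect a b u := lext nu (val (sandwich a b (h u))) - act K a b (mu u).

(** The difference of the two multiples is a h_u c f_u' b - a f_u c h_u' b. Its relator multiples
    have leading words below [w], so [IH] evaluates both terms. *)
Lemma disjoint_confluent a u c u' b :
    Lam u -> Lam u' -> w = (a * u * c * u' * b)%M ->
  defect a (c * u' * b)%M u = defect (a * u * c)%M b u'.
Proof.
move=> Lu Lu' wE; apply: sub_exchange.
(* Expanding f_u' into words smaller than u' makes [IH] applicable; [act_relator_r] then turns the
   resulting action of f_u' back into that of u'. *)
have L : lext nu (<< a >> * val (h u) * << c >> * val (f u') * << b >>)
         = act K a (c * u' * b)%M (mu u).
  rewrite mul_lext linear_lext -act_relator_r //.
  apply: lext_eq_in => w' /(relator_tail_lt Lu') w'u' /=.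
  rewrite -IH //; last by rewrite wE !mulmA; apply: deglex_ltM.
  by rewrite val_sandwich_r.
have L' : lext nu (<< a >> * val (f u) * (<< c >> * val (h u') * << b >>))
          = act K (a * u * c)%M b (mu u').
  rewrite mul_lext linear_lext -act_relator_l //.
  apply: lext_eq_in => w' /(relator_tail_lt Lu) w'u /=.
  rewrite -IH //; last first.
    by rewrite wE; have := deglex_ltM a (c * u' * b)%M w'u; rewrite !mulmA.
  by rewrite val_sandwich_l.
rewrite -L -L' -linearB -[RHS]linearB; congr (lext nu _).
rewrite !val_sandwich -!malgUM.
have UE v : Lam v -> << v >> = val (h v) + val (f v).
  by move=> Lv; rewrite val_relator // subrK.
by rewrite (UE _ Lu) (UE _ Lu'); apply: disjoint_composition.
Qed.

(** The difference of the two multiples is the composition placed between [a] and [b]. Its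
    expression [expr] has only terms below [w], so [IH] applies to each, and [g0] identifies the
    sum. *)
Lemma overlap_confluent a u c e u' b :
    overlap Lam u u' c e -> w = (a * (u * c) * b)%M ->
  defect a (c * b)%M u = defect (a * e)%M b u'.
Proof.
move=> ov wE; apply: sub_exchange.
have [[Lu Lu'] _ _ ucE _] := ov; have [eqn lt_e] := exprP ov.
have -> : act K a (c * b)%M (mu u) - act K (a * e)%M b (mu u')
          = act K a b (ract_word K (mu u) c - lact_word K e (mu u')).
  rewrite ract_wordE lact_wordE linearB /= (act_comp K a 1%M b c).
  by rewrite (act_comp K a e b 1%M) mulm1 mul1m.
have := g0 ov; rewrite /g_elt => /eqP; rewrite subr_eq0 => /eqP <-.
rewrite -linearB !val_sandwich -!malgUM !val_relator //.
have ucE' : << u >> * << c >> = << e >> * << u' >> :> {malg k[_]}.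
  by rewrite !malgUM ucE.
rewrite (overlap_composition _ _ _ _ ucE').
rewrite eqn mulr_sumr mulr_suml !linear_sum /= big_seq [RHS]big_seq.
apply: eq_bigr => -[[[alpha a1] u1] b1] /lt_e[Lu1 lt1].
rewrite malg_scaleAr -scalerAl !linearZ /=; congr (_ *: _).
have lt_w : deglex_lt (a * a1 * u1 * (b1 * b))%M w.
  by rewrite wE; have := deglex_ltM a b lt1; rewrite !mulmA.
rewrite -actE (act_comp K a a1 b b1) -(IH Lu1 lt_w).
rewrite val_sandwich (val_relator Lu1) -!malgUM.
exact: (congr1 (lext nu) (mulr_sandwich _ _ _ _ _)).
Qed.

(** Two occurrences in [w] are disjoint, nested or properly overlapping; minimality makes nested
    ones coincide. *)
Lemma confluent a b u a' b' u' :
    Lam u -> Lam u' -> w = (a * u * b)%M -> w = (a' * u' * b')%M ->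
    (size a <= size a')%N ->
  defect a b u = defect a' b' u'.
Proof.
move=> Lu Lu' wE wE' aa'; move: (wE') => E; rewrite wE -!mulmA in E.
have [e [a'E ube]] := word_cat_split E aa'.
(* First case: [u] ends before [u'] begins. *)
have [ue|eu] := leqP (size u) (size e).
  have [c [eE bE]] := word_cat_split ube ue.
  rewrite bE a'E eE !mulmA; apply: disjoint_confluent => //.
  by rewrite wE bE !mulmA.
have [t [uE tbE]] := word_cat_split (esym ube) (ltnW eu).
(* Second case: [u'] lies inside [u]. Then [u' = u], and comparing lengths shows that [e] and [t']
   are empty, so the decompositions are the same. *)
have [u't|tu'] := leqP (size u') (size t).
  have [t' [tE b'E]] := word_cat_split tbE u't.
  have uu' : u' = u.
    apply: relator_infix => //; apply/infixP; exists e, t'.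
    by rewrite uE tE !fmM.
  have : (size u == size e + (size u + size t'))%N.
    by rewrite {1}uE tE uu' !fmM !size_cat.
  rewrite addnCA -{1}[size u]addn0 eqn_add2l eq_sym addn_eq0 !size_word_eq0.
  by case/andP => /eqP e1 /eqP t'1; rewrite a'E b'E e1 t'1 uu' mulm1 mul1m.
(* Third case: [u] is [e] followed by [t] and [u'] is [t] followed by [c], with [t] nonempty. *)
have [c [u'E bE]] := word_cat_split (esym tbE) (ltnW tu').
have c1 : c != 1%M.
  by apply: contraTneq tu' => c1; rewrite u'E c1 mulm1 ltnn.
have t_gt0 : (0 < size t)%N.
  by move: eu; rewrite uE fmM size_cat -{1}[size e]addn0 ltn_add2l.
(* If [e] were empty, [u] would be a prefix of [u']; minimality would give [u = u'] and thus an
   empty [c]. *)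
have e1 : e != 1%M.
  apply: contra c1 => /eqP e1; have uu' : u = u'.
    apply: relator_infix => //; apply/infixP; exists [::], c.
    by rewrite u'E uE e1 mul1m fmM.
  move/(congr1 (fun v : {fmonom X} => size v)): uu'.
  rewrite u'E uE e1 mul1m fmM size_cat -size_word_eq0 => /eqP.
  by rewrite -{1}[size t]addn0 eqn_add2l eq_sym.
rewrite bE a'E; apply: overlap_confluent; last by rewrite wE bE !mulmA.
split=> //; first by rewrite uE u'E mulmA.
rewrite uE u'E !fmM !size_cat -!addnA !ltn_add2l.
by rewrite -{1}[size c]add0n ltn_add2r.
Qed.

End LocalConfluence.

(** Induction on the word along deg-lex: [confluent] compares an arbitrary decomposition with the
    one for which [nu] satisfies the formula by construction. *)
Lemma normalization : exists nu : {fmonom X} -> M, forall a b u, Lam u ->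
  lext nu (val (sandwich a b (h u))) = act K a b (mu u).
Proof.
have [nu nuP] := normalization_exists; exists nu.
suff nuE w a b u : Lam u -> w = (a * u * b)%M ->
    lext nu (val (sandwich a b (h u))) = act K a b (mu u).
  by move=> a b u Lu; apply: nuE Lu erefl.
elim/(well_founded_ind (deglex_lt_wf wfX)): w a b u => w IHw a b u Lu wE.
have [[[a0 u0] b0] [[/= Lu0 w0E] /= E0]] := nuP w (a, u, b) (conj Lu wE).
have IH a' b' u' : Lam u' -> deglex_lt (a' * u' * b')%M w ->
    lext nu (val (sandwich a' b' (h u'))) = act K a' b' (mu u').
  by move=> Lu' lt'; apply: (IHw _ lt').
apply/eqP; rewrite -subr_eq0; apply/eqP.
have [le_a|le_a] := leqP (size a) (size a0).
  by rewrite (confluent IH Lu Lu0 wE w0E le_a) E0 subrr.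
by rewrite -(confluent IH Lu0 Lu w0E wE (ltnW le_a)) E0 subrr.
Qed.

End Normalization.

(** * The module embeds in the presented extension *)

Section Semidirect.
Variables (k : fieldType) (X : choiceType) (S : free_alg k X -> Prop).
Variables (M : lmodType k) (K : bimodule (presented S) M).

(** The bimodule is a phantom argument, so that the type determines the product attached to it
    below. *)
Definition semidirect of bimodule (presented S) M := (free_alg k X * M)%type.
Local Notation SK := (semidirect K).
HB.instance Definition _ := GRing.Lmodule.on SK.

Definition semidirect_mul (x y : SK) : SK :=
  (x.1 ** y.1, ract K x.2 (class S y.1) + lact K (class S x.1) y.2).

Fact semidirect_mulA : associative semidirect_mul.
Proof.
move=> [p u] [q v] [r w]; congr pair => /=; first exact: nmulA.
by rewrite -[ract K (_ + _) _]/(ract_flip K _ _) !linearD /= !classM ractM lactM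
  /ract_flip lractA addrA.
Qed.

Fact semidirect_mulDl : left_distributive semidirect_mul +%R.
Proof.
move=> [p u] [q v] [r w]; congr pair => /=; first exact: nmulDl.
rewrite -[ract K (_ + _) _]/(ract_flip K _ _) linearD.
by rewrite -[lact K _ _]/(lact_flip K _ _) !linearD addrACA.
Qed.

Fact semidirect_mulDr : right_distributive semidirect_mul +%R.
Proof.
move=> [p u] [q v] [r w]; congr pair => /=; first exact: nmulDr.
by rewrite !linearD addrACA.
Qed.

Fact semidirect_mulZl (c : k) (x y : SK) :
  semidirect_mul (c *: x) y = c *: semidirect_mul x y.
Proof.
case: x y => [p u] [q v]; congr pair => /=; first exact: nmulZl.
rewrite -[ract K (_ *: _) _]/(ract_flip K _ _) linearZ.
by rewrite -[lact K _ _]/(lact_flip K _ _) !linearZ scalerDr.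
Qed.

Fact semidirect_mulZr (c : k) (x y : SK) :
  semidirect_mul x (c *: y) = c *: semidirect_mul x y.
Proof.
case: x y => [p u] [q v]; congr pair => /=; first exact: nmulZr.
by rewrite !linearZ scalerDr.
Qed.

HB.instance Definition _ := Lmodule_isNAlg.Build k SK semidirect_mulA
  semidirect_mulDl semidirect_mulDr semidirect_mulZl semidirect_mulZr.

End Semidirect.

Lemma sandwich_mull (k : fieldType) (Y : choiceType) (a b w : {fmonom Y})
    (p : free_alg k Y) : w != 1%M ->
  sandwich a b (free_word k w ** p) = sandwich (a * w)%M b p.
Proof.
move=> w1; have -> : free_word k w ** p = sandwich w 1%M p.
  by rewrite /sandwich /rmulw eqxx /lmulw (negbTE w1) word_eval_letters.
by rewrite sandwich_comp mul1m.
Qed.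

Lemma sandwich_mulr (k : fieldType) (Y : choiceType) (a b w : {fmonom Y})
    (p : free_alg k Y) : w != 1%M ->
  sandwich a b (p ** free_word k w) = sandwich a (w * b)%M p.
Proof.
move=> w1; have -> : p ** free_word k w = sandwich 1%M w p.
  by rewrite /sandwich /lmulw eqxx /rmulw (negbTE w1) word_eval_letters.
by rewrite sandwich_comp mulm1.
Qed.

Section ModuleInjective.
Variables (k : fieldType) (d : Order.disp_t) (X : orderType d).
Variables (Lam : {fmonom X} -> Prop) (f : {fmonom X} -> free_alg k X).
Variables (M : lmodType k) (K : bimodule (presented (rels Lam f)) M).
Variables (mu nu : {fmonom X} -> M).
Hypothesis nuE : forall a b u, Lam u ->
  lext nu (val (sandwich a b (free_word k u - f u))) = act K a b (mu u).

Local Notation R := (rels Lam f).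

(** Requiring the identity between all words [a] and [b], rather than [lext nu (val p) = - v] alone,
    makes the condition stable under multiplication. *)
Let compatible (p : free_alg k X) (v : M) := forall a b,
  lext nu (val (sandwich a b p)) = - act K a b v.

Lemma compatible_mull q p v :
  compatible p v -> compatible (q ** p) (lact K (class R q) v).
Proof.
move=> pv a b; rewrite -[lact K _ _]/(lact_flip K v _).
elim/free_alg_ind: q => [|q r IHq IHr|c q IHq|w w1].
- by rewrite nmul0r !linear0.
- by rewrite nmulDl !linearD /= IHq IHr -opprD.
- by rewrite nmulZl !linearZ /= IHq.
rewrite sandwich_mull // pv; congr (- _).
by rewrite !actE lact_wordM (lact_word_neq1 _ _ w1).
Qed.

Lemma compatible_mulr q p v :
  compatible p v -> compatible (p ** q) (ract K v (class R q)).
Proof.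
move=> pv a b; elim/free_alg_ind: q => [|q r IHq IHr|c q IHq|w w1].
- by rewrite nmulr0 !linear0.
- by rewrite nmulDr !linearD /= IHq IHr -opprD.
- by rewrite nmulZr !linearZ /= IHq.
rewrite sandwich_mulr // pv; congr (- _).
by rewrite !actE ract_wordM (lract_wordA K a w v) (ract_word_neq1 _ _ w1).
Qed.

(* Up to sign, the graph of the restriction of [nu] to the ideal of [R], where
   it is a bimodule map. *)
Definition graph_ideal : ideal (semidirect K).
Proof.
apply: (@Ideal _ _
  (fun z : semidirect K => class R z.1 = 0 /\ compatible z.1 z.2)).
- by split=> [|a b]; rewrite !linear0 ?oppr0.
- move=> [p u] [q v] [/= p0 pu] [q0 qv]; split=> [|a b] /=.
    by rewrite linearD /= p0 q0 addr0.
  by rewrite !linearD /= pu qv.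
- move=> c [p u] [/= p0 pu]; split=> [|a b] /=.
    by rewrite linearZ /= p0 scaler0.
  by rewrite !linearZ /= pu.
- move=> [p u] [q v] [/= q0 qv]; split=> /=; first by rewrite classM q0 nmulr0.
  (* The second component is the sum of [u] times [q] and [p] times [v]; the first summand vanishes
     because [q] is zero in the presented algebra. *)
  by rewrite q0 linear0 add0r; apply: compatible_mull.
move=> [p u] [q v] [/= p0 pu]; split=> /=; first by rewrite classM p0 nmul0r.
rewrite p0 -[lact K _ _]/(lact_flip K v _) linear0 addr0.
exact: compatible_mulr.
Defined.

Local Notation Q := (quot_alg graph_ideal).

Fact quot_fst_is_linear : linear (fun p => quot_pi graph_ideal (p, 0)).
Proof.
move=> c p q; rewrite -linearP; congr (quot_pi _ _).
by congr pair; rewrite /= scaler0 addr0.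
Qed.

Fact quot_snd_is_linear : linear (fun v => quot_pi graph_ideal (0, v)).
Proof.
move=> c v w; rewrite -linearP; congr (quot_pi _ _).
by congr pair; rewrite /= scaler0 addr0.
Qed.

Let s x : Q := quot_pi graph_ideal (letters k x, 0).
Let i : {linear M -> Q} := linear_of quot_snd_is_linear.

Lemma graph_ext_data : ext_data K mu s i.
Proof.
have sE p : free_lift s p = quot_pi graph_ideal (p, 0).
  pose F := linear_of quot_fst_is_linear.
  have FM : {morph F : p q / p ** q}.
    move=> q r /=; rewrite -quot_piM; congr (quot_pi _ _).
    congr pair; rewrite /= linear0 addr0 -[ract K _ _]/(ract_flip K _ _).
    by rewrite linear0.
  by rewrite -(free_lift_unique (F := F) FM).
split.
(* The claim is that [(h_u, - mu u)] lies in the graph, which is [nuE]. *)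
- move=> u Lu; rewrite sE; apply/quot_piP; split=> [|a b] /=.
    by rewrite subr0; apply: class_rel; exists u.
  by rewrite sub0r subr0 linearN opprK; apply: nuE.
- move=> x v; rewrite -quot_piM; congr (quot_pi _ _); congr pair => /=.
    by rewrite nmulr0.
  by rewrite !linear0 add0r.
- move=> v x; rewrite -quot_piM; congr (quot_pi _ _); congr pair => /=.
    by rewrite nmul0r.
  by rewrite !linear0 addr0.
move=> v w; rewrite -quot_piM -[RHS](linear0 (quot_pi graph_ideal)).
congr (quot_pi _ _); congr pair; rewrite /= ?nmul0r // !linear0 add0r.
exact: (linear0 (lact_flip K w)).
Qed.

Variables (J : choiceType) (m : J -> M).
Hypothesis basis_m : is_basis m.

(** The presented extension maps to the quotient by the graph. If [v] dies there, [(0, v)] is in the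
    graph, and the empty words [a] and [b] give [v = 0]. *)
Lemma pres_m_injective : injective (pres_m K mu basis_m).
Proof.
have [h [_ _ hm]] := pres_lift basis_m graph_ext_data.
move=> v w vw; apply/eqP; rewrite -subr_eq0; apply/eqP.
have /quot_pi_eq0[_ /(_ 1%M 1%M)] : i (v - w) = 0.
  by rewrite -hm linearB /= vw subrr linear0.
by rewrite sandwich11 linear0 act11 => /esym/eqP; rewrite oppr_eq0 => /eqP.
Qed.

End ModuleInjective.

(** * The characterization of extensions *)

Lemma alg_iso_inverse (k : fieldType) (A B : nalgType k) (g : {linear A -> B}) :
    {morph g : x y / x ** y} -> bijective g ->
  exists g' : {linear B -> A},
    [/\ {morph g' : x y / x ** y}, cancel g g' & cancel g' g].
Proof.
move=> gM [g' gK g'K].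
have g'_lin : linear g'.
  by move=> c x y; apply: (can_inj gK); rewrite linearP !g'K.
exists (linear_of g'_lin); split=> // x y /=.
by apply: (can_inj gK); rewrite gM !g'K.
Qed.

(** * From an extension to a bimodule and a family *)

Section ExtensionBimodule.
Variables (k : fieldType) (M B E : nalgType k).
Variables (i : {linear M -> E}) (p : {linear E -> B}).
Hypotheses (i_inj : injective i) (i2 : forall v w, i v ** i w = 0).
Hypothesis pM : {morph p : x y / x ** y}.
Hypothesis p_surj : forall b, exists e, p e = b.
Hypothesis p_ker : forall e, p e = 0 <-> exists v, e = i v.

(** Two lifts of an element of [B] differ by some [i w], which annihilates the image of [i]; the
    action through a lift is therefore independent of the choice. *)
Lemma extension_bimodule : exists K : bimodule B M,
  (forall e v, i (lact K (p e) v) = e ** i v) /\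
  (forall e v, i (ract K v (p e)) = i v ** e).
Proof.
pose l b := projT1 (cid (p_surj b)).
have lK b : p (l b) = b by rewrite /l; case: cid.
have pi v : p (i v) = 0 by apply/p_ker; exists v.
(* [j] inverts [i] on the kernel of [p]; its value [0] elsewhere is a mere default. *)
have [j jK] : {j : E -> M | forall e, p e = 0 -> i (j e) = e}.
  exists (fun e =>
    if pselect (exists v, e = i v) is left ev then projT1 (cid ev) else 0).
  move=> e /p_ker ev; case: pselect => // ev'.
  by rewrite -(projT2 (cid ev')).
have eq_mul e e' v : p e = p e' -> e ** i v = e' ** i v /\ i v ** e = i v ** e'.
  move=> ee'; have [|w ew] := (p_ker (e - e')).1.
    by rewrite linearB ee' subrr.
  by rewrite -[e](subrK e') ew nmulDl nmulDr !i2 !add0r.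
have El b v : i (j (l b ** i v)) = l b ** i v by rewrite jK // pM pi nmulr0.
have Er b v : i (j (i v ** l b)) = i v ** l b by rewrite jK // pM pi nmul0r.
unshelve eexists (@Bimodule k B M (fun b v => j (l b ** i v))
  (fun v b => j (i v ** l b)) _ _ _ _ _ _ _).
- move=> v c b b'; apply: i_inj; rewrite linearP !El -nmulZl -nmulDl.
  by apply: (eq_mul _ _ _ _).1; rewrite linearP !lK.
- move=> b c v v'; apply: i_inj; rewrite El [RHS]linearP /= !El linearP.
  by rewrite nmulDr nmulZr.
- move=> b c v v'; apply: i_inj; rewrite Er [RHS]linearP /= !Er linearP.
  by rewrite nmulDl nmulZl.
- move=> v c b b'; apply: i_inj; rewrite linearP !Er -nmulZr -nmulDr.
  by apply: (eq_mul _ _ _ _).2; rewrite linearP !lK.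
- move=> b b' v; apply: i_inj; rewrite !El nmulA.
  by apply: (eq_mul _ _ _ _).1; rewrite pM !lK.
- move=> b b' v; apply: i_inj; rewrite !Er -nmulA.
  by apply: (eq_mul _ _ _ _).2; rewrite pM !lK.
- by move=> b b' v; apply: i_inj; rewrite Er !El Er nmulA.
split=> e v /=; rewrite ?El ?Er.
  by apply: (eq_mul _ _ _ _).1; rewrite lK.
by apply: (eq_mul _ _ _ _).2; rewrite lK.
Qed.

End ExtensionBimodule.

Section ExtensionPresentation.
Variables (k : fieldType) (d : Order.disp_t) (X : orderType d).
Variables (Lam : {fmonom X} -> Prop) (f : {fmonom X} -> free_alg k X).
Hypothesis Lam_nonempty : forall u, Lam u -> u != 1%M.
Variables (M E : nalgType k).

Local Notation R := (rels Lam f).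

Section Compositions.
Variables (K : bimodule (presented R) M) (mu : {fmonom X} -> M).
Variables (s : X -> E) (i : {linear M -> E}).
Hypothesis si : ext_data K mu s i.

Lemma ext_data_act a b v : i (act K a b v) = rmulw s b (lmulw s a (i v)).
Proof.
rewrite actE /ract_word /lact_word /rmulw /lmulw.
case: eqVneq => [_|b1]; case: eqVneq => [_|a1] //.
- by rewrite -(ext_data_lact si) free_lift_word.
- by rewrite -(ext_data_ract si) free_lift_word.
by rewrite -(ext_data_ract si) -(ext_data_lact si) !free_lift_word.
Qed.

(** Under [i], each a (u) b becomes the image under [s] of a h_u b. The equation g = 0 thus becomes
    the image of the chosen expression of the composition, and [i] is injective. *)
Lemma ext_data_g_elt u1 u2 c dw e : injective i ->
  overlap Lam u1 u2 c dw -> expresses Lam f u1 u2 c dw e ->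
  g_elt K mu u1 u2 c dw e = 0.
Proof.
move=> i_inj [[Lu1 Lu2] _ _ ucE _] [eE Le]; have [rel_s _ _ _] := si.
have iE a b u : Lam u ->
    i (act K a b (mu u)) = free_lift s (sandwich a b (free_word k u - f u)).
  by move=> Lu; rewrite ext_data_act -rel_s // free_lift_sandwich.
rewrite /g_elt ract_wordE lact_wordE; apply/eqP; rewrite subr_eq0; apply/eqP.
apply: i_inj; rewrite linearB /= !iE // -linearB linear_sum.
pose rel_sum := \sum_(t <- e) (let: (alpha, a, u, b) := t in
  alpha *: sandwich a b (free_word k u - f u)).
transitivity (free_lift s rel_sum).
  rewrite /rel_sum linear_sum big_seq [RHS]big_seq.
  apply: eq_bigr => -[[[alpha a] u] b] /Le[Lu _].
  by rewrite !linearZ /= -actE iE.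
congr (free_lift s _); apply: val_inj; rewrite linear_sum.
have val_rel u : Lam u -> val (free_word k u - f u) = << u >> - val (f u).
  by move/Lam_nonempty; apply: val_free_wordB.
transitivity (<< dw >> * val (f u2) - val (f u1) * << c >>).
  rewrite eE big_seq [RHS]big_seq.
  apply: eq_bigr => -[[[alpha a] u] b] /Le[Lu _].
  by rewrite linearZ /= val_sandwich val_rel.
have sand1l c' p : val (sandwich 1%M c' p) = val p * << c' >> :> {malg k[_]}.
  by rewrite val_sandwich [X in X * _]mul1r.
have sand1r c' p : val (sandwich c' 1%M p) = << c' >> * val p :> {malg k[_]}.
  by rewrite val_sandwich [LHS]mulr1.
transitivity (val (sandwich 1%M c (free_word k u1 - f u1))
              - val (sandwich dw 1%M (free_word k u2 - f u2))); last by [].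
rewrite sand1l sand1r (val_rel _ Lu1) (val_rel _ Lu2).
by apply/esym/overlap_difference; rewrite !malgUM ucE.
Qed.

End Compositions.

End ExtensionPresentation.

(** Both sides are algebra maps on the free algebra that agree on letters. *)
Lemma free_lift_section (k : fieldType) (Y : choiceType)
    (S : free_alg k Y -> Prop) (E : nalgType k) (p : {linear E -> presented S})
    (s : Y -> E) :
    {morph p : x y / x ** y} ->
    (forall y, p (s y) = class S (letters k y)) ->
  forall q, p (free_lift s q) = class S q.
Proof.
move=> pM ps q; rewrite classE.
apply: (free_lift_unique (F := p \o free_lift s)) => [q1 q2|y] /=.
  by rewrite free_liftM pM.
by rewrite free_lift_word ps.
Qed.

Lemma extension_iso_presented (k : fieldType) (d : Order.disp_t)
    (X : orderType d)
    (Lam : {fmonom X} -> Prop) (f : {fmonom X} -> free_alg k X)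
    (M E : nalgType k) (K : bimodule (presented (rels Lam f)) M)
    (mu : {fmonom X} -> M) (s : X -> E) (i : {linear M -> E})
    (p : {linear E -> presented (rels Lam f)})
    (J : choiceType) (m : J -> M) (basis_m : is_basis m) :
    ext_data K mu s i -> injective i -> {morph p : x y / x ** y} ->
    (forall e, p e = 0 <-> exists v, e = i v) ->
    (forall x, p (s x) = class (rels Lam f) (letters k x)) ->
  alg_iso E (presented (ext_rels K m Lam f mu)).
Proof.
move=> si i_inj pM p_ker ps.
have pi v : p (i v) = 0 by apply/p_ker; exists v.
have psE := free_lift_section pM ps.
have [h [hM hx hm]] := pres_lift basis_m si.
have h_bij : bijective h.
  apply: inj_surj_bij => [z z' /eqP|e].
    rewrite -subr_eq0 -linearB => /eqP hz; apply/eqP; rewrite -subr_eq0.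
    move: hz; have [q [v ->]] := pres_decomp basis_m (z - z').
    rewrite linearD /= hx hm => qv0.
    (* The image of [q] under [s] is [- i v], which [p] kills. Hence its value in the presented
       extension is some [pres_m v'], and injectivity of [i] forces [v' + v = 0]. *)
    have /class_eq0 Rq : class (rels Lam f) q = 0.
      rewrite -psE -[free_lift s q](addrK (i v)) qv0 sub0r linearN /= pi.
      exact: oppr0.
    have [v' qv'] := ext_data_ideal (pres_ext_data K mu basis_m) Rq.
    have qiv' : free_lift s q = i v' by rewrite -hx qv' hm.
    rewrite qv' -linearD (_ : v' + v = 0) ?linear0 //.
    by apply: i_inj; rewrite linearD /= -qiv' qv0 linear0.
  (* Surjectivity: [e] differs from the image of a lift [q] of [p e] by an element of the kernel. *)
  have [q qE] := class_surj (p e).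
  have [|v ev] := (p_ker (e - free_lift s q)).1.
    by rewrite linearB /= psE qE subrr.
  exists (free_lift (pres_x K mu m) q + pres_m K mu basis_m v).
  by rewrite linearD /= hx hm -ev addrC subrK.
have [h' [h'M hK h'K]] := alg_iso_inverse hM h_bij.
by exists h'; split=> //; exists h.
Qed.

Lemma presented_exact (k : fieldType) (d : Order.disp_t)
    (X : orderType d)
    (Lam : {fmonom X} -> Prop) (f : {fmonom X} -> free_alg k X)
    (M : nalgType k) (K : bimodule (presented (rels Lam f)) M)
    (mu : {fmonom X} -> M)
    (J : choiceType) (m : J -> M) (basis_m : is_basis m) :
  exists p : {linear presented (ext_rels K m Lam f mu)
                     -> presented (rels Lam f)},
    [/\ {morph p : x y / x ** y}, forall b, exists z, p z = b
      & forall z, p z = 0 <-> exists v, z = pres_m K mu basis_m v].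
Proof.
pose B := presented (rels Lam f).
pose s x : B := class (rels Lam f) (letters k x).
have zero_lin : linear (fun _ : M => 0 : B).
  by move=> c v w; rewrite scaler0 addr0.
(* The projection comes from the universal property, with the zero map on [M]. *)
have si : ext_data K mu s (linear_of zero_lin).
  split=> [u Lu|x v|v x|v w] /=; rewrite ?nmulr0 ?nmul0r //.
  by rewrite -classE class_rel //; exists u.
have [p [pM px pm]] := pres_lift basis_m si; exists p; split=> // [b|z].
  have [q <-] := class_surj b; exists (free_lift (pres_x K mu m) q).
  by rewrite px -classE.
split=> [|[v ->]]; last exact: pm.
have [q [v ->]] := pres_decomp basis_m z.
rewrite linearD /= px pm addr0 -classE => /class_eq0 Rq.
have [v' ->] := ext_data_ideal (pres_ext_data K mu basis_m) Rq.
by exists (v' + v); rewrite linearD.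
Qed.

Theorem theorem2p6 (k : fieldType)
  (d : Order.disp_t) (X : orderType d)
  (wfX : well_founded (fun x y : X => (x < y)%O))
  (Lam : {fmonom X} -> Prop) (f : {fmonom X} -> free_alg k X)
  (Lam_nonempty : forall u, Lam u -> u != 1%M)
  (lead_h : forall u, Lam u -> lead (free_val (free_word k u - f u)) = u)
  (GS_R : GS_basis (rels Lam f)) (min_R : GS_minimal (rels Lam f))
  (expr : {fmonom X} -> {fmonom X} -> {fmonom X} ->
          seq (k * {fmonom X} * {fmonom X} * {fmonom X}))
  (exprP : forall u1 u2 c dw, overlap Lam u1 u2 c dw ->
     expresses Lam f u1 u2 c dw (expr u1 u2 (u1 * c)%M))
  (M E : nalgType k) (M2 : forall x y : M, x ** y = 0)
  (J : choiceType) (m : J -> M) (basis_m : is_basis m) :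
  is_extension_of M (presented (rels Lam f)) E <->
  exists (K : bimodule (presented (rels Lam f)) M) (mu : {fmonom X} -> M),
    (forall u1 u2 c dw, overlap Lam u1 u2 c dw ->
       g_elt K mu u1 u2 c dw (expr u1 u2 (u1 * c)%M) = 0) /\
    alg_iso E (presented (ext_rels K m Lam f mu)).
Proof.
rewrite is_extensionP //; split.
  move=> [i [p [i_inj i2 pM p_surj p_ker]]].
  have [K [Kl Kr]] := extension_bimodule i_inj i2 pM p_surj p_ker.
  pose s x := projT1 (cid (p_surj (class (rels Lam f) (letters k x)))).
  have ps x : p (s x) = class (rels Lam f) (letters k x).
    by rewrite /s; case: cid.
  have psE := free_lift_section pM ps.
  (* Only the values on [Lam] are constrained; elsewhere [0] is a witness. *)
  have mu_ex u : exists v, Lam u -> free_lift s (free_word k u - f u) = i v.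
    have [Lu|nLu] := pselect (Lam u); last by exists 0.
    have [|v uv] := (p_ker (free_lift s (free_word k u - f u))).1;
      last by exists v.
    by rewrite psE class_rel //; exists u.
  pose mu u := projT1 (cid (mu_ex u)).
  have si : ext_data K mu s i.
    split=> // [u Lu|x v|v x]; [|by rewrite -ps Kl|by rewrite -ps Kr].
    exact: (projT2 (cid (mu_ex u)) Lu).
  exists K, mu; split; last exact: extension_iso_presented si i_inj pM p_ker ps.
  move=> u1 u2 c dw ov; apply: (ext_data_g_elt Lam_nonempty si i_inj ov).
  exact: exprP.
move=> [K [mu [g0 [g [gM g_bij]]]]].
have [g' [g'M gK g'K]] := alg_iso_inverse gM g_bij.
have monic_h u : Lam u -> Defs.monic (val (free_word k u - f u)).
  by move=> Lu; apply: GS_R.1; exists u.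
have [nu nuE] := normalization wfX Lam_nonempty lead_h monic_h min_R exprP g0.
have pres_m_inj := @pres_m_injective _ _ _ _ _ _ _ _ _ nuE _ _ basis_m.
have [_ _ _ pres_m2] := pres_ext_data K mu basis_m.
have [p [pM p_surj p_ker]] := presented_exact K mu basis_m.
(* The exact sequence of the presented extension is transported to [E] along the isomorphism. *)
exists (g' \o pres_m K mu basis_m), (p \o g); split=> /=.
- by move=> v w /(can_inj g'K); apply: pres_m_inj.
- by move=> v w; rewrite -g'M pres_m2 linear0.
- by move=> x y /=; rewrite gM pM.
- by move=> b; have [z <-] := p_surj b; exists (g' z); rewrite g'K.
move=> e; rewrite p_ker; split=> -[v ev]; exists v; first by rewrite -ev gK.
by rewrite ev g'K.
Qed.
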